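(* Under the Setup and the Unconditional asymptotic regime described in the context, for $i=0,1$, $$\lim_{p\to\infty} E_{\boldsymbol\mu,S_n}[\hat\varepsilon_i^B]=\Phi\!\left((-1)^i\,\frac{-H_i+c}{\sqrt F}\right),$$ and consequently $$\lim_{p\to\infty} E_{\boldsymbol\mu,S_n}[\hat\varepsilon^B]=\alpha_0\,\Phi\!\left(\frac{-H_0+c}{\sqrt F}\right)+\alpha_1\,\Phi\!\left(\frac{H_1-c}{\sqrt F}\right),$$ where $H_0=\frac12\big(\bar\Delta^2_{\mathbf m}+J_1-J_0+\frac{J_0}{\gamma_0}+\frac{J_1}{\gamma_1}\big)$, $H_1=-\frac12\big(\bar\Delta^2_{\mathbf m}+J_0-J_1+\frac{J_0}{\gamma_0}+\frac{J_1}{\gamma_1}\big)$, and $F=\bar\Delta^2_{\mathbf m}+J_0+J_1+\frac{J_0}{\gamma_0}+\frac{J_1}{\gamma_1}$.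
   Context: Setup. Fix $\alpha_0\in(0,1)$, $\alpha_1=1-\alpha_0$, and $c=\log\frac{1-\alpha_0}{\alpha_0}$. $\Phi$ is the standard normal CDF. For each dimension $p$ there is a known symmetric positive definite $p\times p$ matrix $\Sigma$, sample sizes $n_0,n_1$, prior means $\mathbf m_0,\mathbf m_1\in\mathbb R^p$ and prior certainty parameters $\nu_0,\nu_1>0$ (all depending on $p$; the index $p$ is suppressed). The class means are random: $\boldsymbol\mu_i\sim N(\mathbf m_i,\Sigma/\nu_i)$, $i=0,1$, independent; $\boldsymbol\mu=(\boldsymbol\mu_0,\boldsymbol\mu_1)$. Given $\boldsymbol\mu$, class $i$ has distribution $\Pi_i=N(\boldsymbol\mu_i,\Sigma)$, and the sample $S_n$ consists of $n_0$ i.i.d. points from $\Pi_0$ and, independently, $n_1$ i.i.d. points from $\Pi_1$; $\bar{\mathbf x}_0,\bar{\mathbf x}_1$ are the class sample means. The LDA classifier assigns $\mathbf x$ to class 1 if $W(\mathbf x)\le c$ and to class 0 otherwise, where $W(\mathbf x)=(\mathbf x-\frac{\bar{\mathbf x}_0+\bar{\mathbf x}_1}{2})^T\Sigma^{-1}(\bar{\mathbf x}_0-\bar{\mathbf x}_1)$. Let $\hat\delta^2=(\bar{\mathbf x}_0-\bar{\mathbf x}_1)^T\Sigma^{-1}(\bar{\mathbf x}_0-\bar{\mathbf x}_1)$. The true error is $\varepsilon=\alpha_0\varepsilon_0+\alpha_1\varepsilon_1$ with $\varepsilon_i=\Phi\Big(\frac{(-1)^{i+1}(\boldsymbol\mu_i-\frac{\bar{\mathbf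 x}_0+\bar{\mathbf x}_1}{2})^T\Sigma^{-1}(\bar{\mathbf x}_0-\bar{\mathbf x}_1)+(-1)^i c}{\hat\delta}\Big)$. The Bayesian MMSE error estimator is $\hat\varepsilon^B=\alpha_0\hat\varepsilon^B_0+\alpha_1\hat\varepsilon^B_1$ with $\hat\varepsilon_i^B=\Phi\Big((-1)^i\frac{-(\mathbf m_i^*-\frac{\bar{\mathbf x}_0+\bar{\mathbf x}_1}{2})^T\Sigma^{-1}(\bar{\mathbf x}_0-\bar{\mathbf x}_1)+c}{\hat\delta}\sqrt{\frac{\nu_i^*}{\nu_i^*+1}}\Big)$, where $\mathbf m_i^*=\frac{n_i\bar{\mathbf x}_i+\nu_i\mathbf m_i}{n_i+\nu_i}$ and $\nu_i^*=n_i+\nu_i$. Notation: $\Delta^2_{\mathbf m}=(\mathbf m_0-\mathbf m_1)^T\Sigma^{-1}(\mathbf m_0-\mathbf m_1)$, and $\bar\Delta^2_{\mathbf m}$ its limit as $p\to\infty$. Unconditional asymptotic regime. Expectations $E_{\boldsymbol\mu,S_n}$ are over both $\boldsymbol\mu$ and the sample. As $p\to\infty$: $n_0,n_1,\nu_0,\nu_1\to\infty$, $p/n_i\to J_i\in[0,\infty)$, $\nu_i/n_i\to\gamma_i\in(0,\infty)$, and for all $i,j\in\{0,1\}$, $\mathbf m_i^T\Sigma^{-1}\mathbf m_j$ converges to a finite limit. It is assumed that $F>0$ (with $F$ as in the claim). $\lim_{p\to\infty}$ denotes the limit along this regime. *)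

(* Defs.v *)
From HB Require Import structures.
From mathcomp Require Import all_boot all_order all_algebra.
From mathcomp Require Import all_classical all_reals all_analysis.
Set Implicit Arguments. Unset Strict Implicit. Unset Printing Implicit Defensive.
Import Order.TTheory GRing.Theory Num.Theory.
Import numFieldNormedType.Exports.
Local Open Scope classical_set_scope.
Local Open Scope ring_scope.

Definition Phi (R : realType) (x : R) : R :=
  Rintegral (@lebesgue_measure R) [set y | y <= x] (normal_pdf 0 1).

(* Expectation E[g(Z_0,...,Z_{N-1})] where Z_0, Z_1, ... are i.i.d. N(0,1):
   iterated integral against the standard normal probability measure.
   Coordinates with index >= N are set to 0 (g must only use the first N). *)
Fixpoint gexp (R : realType) (N : nat) (g : (nat -> R) -> R) : R :=
  match N with
  | 0 => g (fun _ => 0)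
  | N'.+1 => Rintegral (normal_prob (0:R) 1) setT
      (fun x => gexp N' (fun z => g (fun k => if k is k'.+1 then z k' else x)))
  end.

Definition blk (R : realType) (p : nat) (z : nat -> R) (b : nat) : 'cV[R]_p :=
  \col_(r < p) z (b * p + r)%N.

Definition quad (R : realType) (p : nat) (Sigma : 'M[R]_p) (u v : 'cV[R]_p) : R :=
  ((u^T *m invmx Sigma *m v) 0 0).

(* Random class means, realized from standard normals via a factor L with
   L L^T = Sigma:  mu_i = m_i + nu_i^{-1/2} L Z_i  ~  N(m_i, Sigma/nu_i). *)
Definition mu_rv (R : realType) (p : nat) (L : 'M[R]_p) (m : 'cV[R]_p) (nu : R)
  (z : nat -> R) (b : nat) : 'cV[R]_p :=
  m + (Num.sqrt nu)^-1 *: (L *m blk p z b).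

(* Sample means of the class-0 points x_{0,j} = mu_0 + L W_{0,j} (j < n0) and
   class-1 points x_{1,j} = mu_1 + L W_{1,j} (j < n1).  Block layout of z:
   0 : Z_0, 1 : Z_1, 2..n0+1 : W_{0,j}, n0+2..n0+n1+1 : W_{1,j}. *)
Definition xbar (R : realType) (p : nat) (L : 'M[R]_p) (m0 m1 : 'cV[R]_p)
  (n0 n1 : nat) (nu0 nu1 : R) (z : nat -> R) (i : bool) : 'cV[R]_p :=
  if i then
    (n1%:R)^-1 *: \sum_(j < n1)
       (mu_rv L m1 nu1 z 1 + L *m blk p z (2 + n0 + j)%N)
  else
    (n0%:R)^-1 *: \sum_(j < n0)
       (mu_rv L m0 nu0 z 0 + L *m blk p z (2 + j)%N).

Definition Ndim (p n0 n1 : nat) : nat := (p * (2 + n0 + n1))%N.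

Definition cthr (R : realType) (alpha0 : R) : R := ln ((1 - alpha0) / alpha0).

Definition epsB_i (R : realType) (p : nat) (Sigma : 'M[R]_p) (m0 m1 : 'cV[R]_p)
  (n0 n1 : nat) (nu0 nu1 alpha0 : R) (xb0 xb1 : 'cV[R]_p) (i : bool) : R :=
  let ni := (if i then n1 else n0)%:R in
  let nui := if i then nu1 else nu0 in
  let mi := if i then m1 else m0 in
  let xbi := if i then xb1 else xb0 in
  let mstar := (ni + nui)^-1 *: (ni *: xbi + nui *: mi) in
  let nustar := ni + nui in
  let deltahat := Num.sqrt (quad Sigma (xb0 - xb1) (xb0 - xb1)) in
  Phi ((-1) ^+ i *
       ((- quad Sigma (mstar - (2%:R)^-1 *: (xb0 + xb1)) (xb0 - xb1)
         + cthr alpha0) / deltahat * Num.sqrt (nustar / (nustar + 1)))).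

Definition E_epsB_i (R : realType) (p : nat) (Sigma L : 'M[R]_p) (m0 m1 : 'cV[R]_p)
  (n0 n1 : nat) (nu0 nu1 alpha0 : R) (i : bool) : R :=
  gexp (Ndim p n0 n1) (fun z =>
    epsB_i Sigma m0 m1 n0 n1 nu0 nu1 alpha0
      (xbar L m0 m1 n0 n1 nu0 nu1 z false) (xbar L m0 m1 n0 n1 nu0 nu1 z true) i).

Definition E_epsB (R : realType) (p : nat) (Sigma L : 'M[R]_p) (m0 m1 : 'cV[R]_p)
  (n0 n1 : nat) (nu0 nu1 alpha0 : R) : R :=
  gexp (Ndim p n0 n1) (fun z =>
    let xb0 := xbar L m0 m1 n0 n1 nu0 nu1 z false in
    let xb1 := xbar L m0 m1 n0 n1 nu0 nu1 z true in
    alpha0 * epsB_i Sigma m0 m1 n0 n1 nu0 nu1 alpha0 xb0 xb1 false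
    + (1 - alpha0) * epsB_i Sigma m0 m1 n0 n1 nu0 nu1 alpha0 xb0 xb1 true).

(* Main.v *)
Require Import Defs.
From HB Require Import structures.
From mathcomp Require Import all_boot all_order all_algebra.
From mathcomp Require Import all_classical all_reals all_analysis.
From mathcomp Require Import measurable_realfun.
From mathcomp Require Import ring lra.
Import Order.TTheory GRing.Theory Num.Theory.
Import numFieldNormedType.Exports.
Local Open Scope classical_set_scope.
Local Open Scope ring_scope.

(* After whitening by L, both the squared distance deltahat^2 and the numerator
   of the discriminant are polynomials of degree two in the i.i.d. N(0,1)
   coordinates. A quadratic polynomial c + l.z + z^T Q z has second moment
   (c + tr Q)^2 + |l|^2 + sum_ij Q_ij (Q_ij + Q_ji), and in the asymptotic regime
   this gives mean-square convergence of deltahat^2 to F and of the numerator to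
   H_i. Since Phi takes values in [0, 1] and is continuous, a Chebyshev-type
   pointwise bound |Phi(..) - Phi(lim)| <= eps + K ((A - H_i)^2 + (B - F)^2)
   turns this into convergence of the expectations. *)

(** * Moments of the standard normal law *)

Section StandardNormalMoments.
Context {R : realType}.
Local Notation mu := (@lebesgue_measure R).
Local Notation phi := (normal_pdf (0 : R) 1).
Local Notation gauss := (normal_prob (0 : R) 1).

(** [gexp] iterates real-valued integrals, so it is linear and monotone only under integrability at
    every level. Hence [gint] travels with each computation, and second moments are found by
    integrating out one coordinate at a time. Each whitened coordinate of the class-i sample mean
    has variance s_i = 1/nu_i + 1/n_i, which tends to 0, while p s_i tends to P_i = J_i +
    J_i/gamma_i. The classes being independent, the mean of deltahat^2 tends to Dm + P_0 + P_1 = F.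
    In the numerator, the posterior mean keeps only the fraction n_i/(n_i + nu_i) of the noise of
    its sample mean; this fraction tends to 1/(1 + gamma_i), and P_i/(1 + gamma_i) = J_i/gamma_i, so
    J_i and J_i/gamma_i enter H_i with different signs. The variances consist of terms of order D
    s_i and p s_i s_j, which vanish. *)

Lemma normal_pdf01E (x : R) : phi x = normal_peak 1 * expR (- (x ^+ 2 / 2)).
Proof.
rewrite normal_pdfE ?oner_eq0// /normal_fun subr0 expr1n mulNr.
by rewrite -[(1 *+ 2)]/(2%:R).
Qed.

Lemma is_derive_mulX_normal_pdf01 n (x : R) :
  is_derive x 1 (fun x : R => - (x ^+ n.+1 * phi x))
    ((x ^+ n.+2 - n.+1%:R * x ^+ n) * phi x).
Proof.
have dphi : is_derive x 1 phi (- x * phi x).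
  have -> : phi = (fun x => normal_peak 1 * expR (- (x ^+ 2 / 2))).
    by apply/funext => y; rewrite normal_pdf01E.
  by apply: is_derive_eq; rewrite /GRing.scale/=; field.
have dX : is_derive x 1 (fun x : R => x ^+ n.+1) (n.+1%:R * x ^+ n).
  have h := @exprn_derivable R n.+1 x 1.
  apply: DeriveDef => //; rewrite exp_derive.
  by rewrite /GRing.scale/= mulr1.
have -> : (x ^+ n.+2 - n.+1%:R * x ^+ n) * phi x =
   - (x ^+ n.+1 *: (- x * phi x) + phi x *: (n.+1%:R * x ^+ n)).
  by rewrite /GRing.scale/= !exprS; ring.
exact: is_deriveN (is_deriveM dX dphi).
Qed.

Lemma continuous_mulX_normal_pdf01 n : continuous (fun x : R => x ^+ n * phi x).
Proof.
move=> x; apply: cvgM; first exact: exprn_continuous.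
exact: (@continuous_normal_pdf R 0 1 (oner_neq0 R)).
Qed.

Lemma cvgy_mulX_normal_pdf01 n : (x ^+ n * phi x) @[x --> +oo] --> (0 : R).
Proof.
have peak0 := normal_peak_ge0 (1 : R).
(* From exp(y) >= y^(n+1)/(n+1)! at y = x^2/2, and x^(2(n+1)) >= x^(n+1) for x >= 1, one gets x^n
   phi(x) <= C/x. *)
pose C : R := normal_peak 1 * (n.+1`!%:R * 2 ^+ n.+1).
have C0 : 0 <= C by rewrite !mulr_ge0.
apply: (@squeeze_cvgr _ _ _ _ (cst 0) (fun x => C * x^-1)).
- near=> x.
  have x1 : 1 <= x by near: x; exact: nbhs_pinfty_ge.
  have x0 : 0 < x by lra.
  rewrite mulr_ge0 ?exprn_ge0 ?normal_pdf_ge0 ?(ltW x0)//=.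
  rewrite normal_pdf01E /C mulrCA -[leRHS]mulrA ler_wpM2l//.
  rewrite expRN ler_pdivrMr ?expR_gt0// mulrAC ler_pdivlMr// -exprSr.
  have D0 : 0 < n.+1`!%:R * 2 ^+ n.+1 :> R.
    by rewrite mulr_gt0 ?exprn_gt0 ?ltr0n ?fact_gt0.
  rewrite -ler_pdivrMl//.
  have y0 : 0 <= x ^+ 2 / 2 by rewrite divr_ge0 ?exprn_ge0 ?(ltW x0).
  apply: le_trans (expR_ge1Dxn n y0).
  rewrite -[leLHS]add0r lerD//.
  rewrite expr_div_n -[leRHS]mulrA -invfM [2 ^+ _ * _]mulrC [leRHS]mulrC.
  rewrite ler_pM2l ?invr_gt0//.
  by rewrite -exprM ler_weXn2l// mul2n -addnn leq_addr.
- exact: cvg_cst.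
- rewrite -[X in _ --> X](mulr0 C); apply: cvgMl_tmp.
  apply/gtr0_cvgV0; last exact: cvg_id.
  exact: nbhs_pinfty_gt.
Unshelve. all: by end_near. Qed.

(* FTC applies on [0, n+1] by compactness and on [n+1, +oo[ because there the
   derivative of - x^(n+1) phi(x) is nonnegative. *)
Lemma integral_mulX_normal_pdf01S n :
  (\int[mu]_(x in `[0%R, +oo[) (x ^+ n.+2 * phi x)%:E =
   n.+1%:R%:E * \int[mu]_(x in `[0%R, +oo[) (x ^+ n * phi x)%:E)%E.
Proof.
pose f n (x : R) := x ^+ n * phi x.
have cf k : continuous (f k) by exact: continuous_mulX_normal_pdf01.
have mf k : measurable_fun setT (f k) by exact: continuous_measurable_fun.
have mEf k : measurable_fun setT (EFin \o f k) by exact/measurable_EFinP.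
have f0 k x : 0 <= x -> 0 <= f k x.
  by move=> x0; rewrite mulr_ge0 ?exprn_ge0 ?normal_pdf_ge0.
pose b : R := n.+1%:R.
have b1 : 1 <= b by rewrite ler1n.
have b0 : 0 < b by rewrite ltr0n.
pose h (x : R) := (x ^+ n.+2 - n.+1%:R * x ^+ n) * phi x.
pose F (x : R) := - (x ^+ n.+1 * phi x).
have dF (x : R) : is_derive x 1 F (h x) by exact: is_derive_mulX_normal_pdf01.
have hE x : h x = f n.+2 x - n.+1%:R * f n x by rewrite /h /f; ring.
have ch : continuous h.
  move=> x; rewrite (_ : h = fun x => f n.+2 x - n.+1%:R * f n x).
    by apply: cvgB; [exact: cf|apply: cvgMl_tmp; exact: cf].
  by apply/funext => y.
have cF : continuous F by move=> x; apply: cvgN; exact: cf.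
have F0 : F 0 = 0 by rewrite /F exprS !mul0r oppr0.
have Fy : F x @[x --> +oo] --> (0 : R).
  by rewrite -oppr0; apply: cvgN; exact: cvgy_mulX_normal_pdf01.
have h0 x : b <= x -> 0 <= h x.
  move=> bx; have x1 : 1 <= x by exact: le_trans bx.
  have x0 : 0 <= x by lra.
  rewrite mulr_ge0 ?normal_pdf_ge0// 2!exprS mulrA -mulrBl mulr_ge0 ?exprn_ge0//.
  by rewrite subr_ge0 -/b; nra.
have int1 : (\int[mu]_(x in `[0%R, b]) (h x)%:E = (F b)%:E)%E.
  rewrite (@continuous_FTC2 _ _ F)//; last 3 first.
  - exact: continuous_subspaceT.
  - split.
    + by move=> x _; exact: ex_derive.
    + by apply: cvg_at_right_filter; exact: cF.
    + by apply: cvg_at_left_filter; exact: cF.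
  - by move=> x _; rewrite derive1E; exact: derive_val.
  by rewrite F0 sube0.
have int2 : (\int[mu]_(x in `[b, +oo[) (h x)%:E = - (F b)%:E)%E.
  rewrite (@ge0_continuous_FTC2y _ _ F b 0)//.
  - by rewrite sub0e.
  - exact: continuous_subspaceT.
  - by apply: cvg_at_right_filter; exact: cF.
  - by move=> x _; rewrite derive1E; exact: derive_val.
have split_at_b k : (\int[mu]_(x in `[0%R, +oo[) (f k x)%:E =
    \int[mu]_(x in `[0%R, b]) (f k x)%:E + \int[mu]_(x in `[b, +oo[) (f k x)%:E)%E.
  rewrite (@itv_bndbnd_setU _ _ _ (BRight b))//; last by rewrite bnd_simp ltW.
  rewrite ge0_integral_setU//=.
  - by rewrite integral_itv_obnd_cbnd//; apply/measurable_EFinP/measurable_funTS.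
  - by apply: measurable_funTS; exact: mEf.
  - move=> x [|] /=; rewrite in_itv/= => /andP[x0 _]; rewrite lee_fin f0//.
    by rewrite (le_trans (ltW b0))// ltW.
  - rewrite disj_set2E; apply/eqP; rewrite -subset0 => x [] /=.
    by rewrite !in_itv/= andbT => /andP[_ xb]; rewrite ltNge xb.
have fE x : f n.+2 x = h x + n.+1%:R * f n x by rewrite hE subrK.
rewrite -!/(f _ _) !split_at_b ge0_muleDr; last 2 first.
- by apply: integral_ge0 => x /=; rewrite in_itv/= => /andP[? _]; rewrite lee_fin f0.
- apply: integral_ge0 => x /=; rewrite in_itv/= andbT => bx.
  by rewrite lee_fin f0// (le_trans (ltW b0)).
have -> : (\int[mu]_(x in `[0%R, b]) (f n.+2 x)%:E =
    (F b)%:E + n.+1%:R%:E * \int[mu]_(x in `[0%R, b]) (f n x)%:E)%E.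
  have ci (g : R -> R) : continuous g -> mu.-integrable `[0%R, b] (EFin \o g).
    move=> cg; apply: continuous_compact_integrable; first exact: segment_compact.
    exact: continuous_subspaceT.
  under eq_integral do rewrite fE EFinD.
  rewrite integralD_EFin//=; [|exact: ci|].
    rewrite int1; congr (_ + _)%E; under eq_integral do rewrite EFinM.
    by rewrite integralZl//; exact: ci.
  by apply: ci => x; apply: cvgMl_tmp; exact: cf.
have -> : (\int[mu]_(x in `[b, +oo[) (f n.+2 x)%:E =
    - (F b)%:E + n.+1%:R%:E * \int[mu]_(x in `[b, +oo[) (f n x)%:E)%E.
  under eq_integral do rewrite fE EFinD.
  have fn0 x : x \in `[b, +oo[ -> 0 <= f n x.
    by rewrite in_itv/= andbT => bx; rewrite f0// (le_trans (ltW b0)).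
  have mEh : measurable_fun setT (EFin \o h).
    by apply/measurable_EFinP; exact: continuous_measurable_fun.
  have mEnf : measurable_fun setT (EFin \o (fun x => n.+1%:R * f n x)).
    by apply/measurable_EFinP; apply: measurable_funM.
  rewrite ge0_integralD//=.
  - rewrite int2; congr (_ + _)%E; under eq_integral do rewrite EFinM.
    by rewrite ge0_integralZl//=; apply: measurable_funTS; exact: mEf.
  - by move=> x; rewrite in_itv/= andbT => bx; rewrite lee_fin h0.
  - by apply: measurable_funTS; exact: mEh.
  - by move=> x bx; rewrite lee_fin mulr_ge0// fn0.
  - by apply: measurable_funTS; exact: mEnf.
by rewrite addeACA -EFinB subrr add0e.
Qed.

(** Parity reduces both integrals to the half-line, where integration by parts applies. The
    recursion holds in the extended reals, so finiteness follows from it by induction, starting at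
    the total mass of the density. *)
Lemma integral_even_normal_pdf01 k :
  (\int[mu]_x (x ^+ k.*2 * phi x)%:E < +oo)%E /\
  (\int[mu]_x (x ^+ k.+1.*2 * phi x)%:E =
   k.*2.+1%:R%:E * \int[mu]_x (x ^+ k.*2 * phi x)%:E)%E.
Proof.
have sym j : (\int[mu]_x (x ^+ j.*2 * phi x)%:E =
    2%:E * \int[mu]_(x in `[0%R, +oo[) (x ^+ j.*2 * phi x)%:E)%E.
  rewrite set_itvcy ge0_symfun_integralT//.
  - by move=> x; rewrite mulr_ge0 ?normal_pdf_ge0// exprn_even_ge0// odd_double.
  - exact: continuous_mulX_normal_pdf01.
  - move=> x /=; rewrite !normal_pdf01E sqrrN exprNn.
    by rewrite -signr_odd odd_double expr0 mul1r.
have step j : (\int[mu]_x (x ^+ j.+1.*2 * phi x)%:E =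
   j.*2.+1%:R%:E * \int[mu]_x (x ^+ j.*2 * phi x)%:E)%E.
  by rewrite !sym doubleS integral_mulX_normal_pdf01S muleCA.
split=> //; elim: k => [|k IHk]; last by rewrite step lte_mul_pinfty.
under eq_integral do rewrite expr0 mul1r.
by rewrite integral_normal_pdf ltry.
Qed.

(** Change of variables through the Radon-Nikodym derivative, which is determined only up to null
    sets; having the same integrals as [phi] on measurable sets, it agrees with [phi] almost
    everywhere. *)
Lemma integrable_integral_normal_prob (f : R -> R) :
  gauss.-integrable setT (EFin \o f) ->
  (\int[gauss]_x (f x)%:E = \int[mu]_x (f x * phi x)%:E)%E.
Proof.
move=> intf; have [mEf _] := integrableP _ _ _ intf.
have dom : gauss `<< mu := normal_prob_dominates 0 1.
rewrite -(Radon_Nikodym_change_of_variables dom measurableT intf)//=.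
under [RHS]eq_integral do rewrite EFinM.
apply: ae_eq_integral => //.
- exact: emeasurable_funM.
- apply: emeasurable_funM => //.
  by apply/measurable_EFinP; exact: measurable_normal_pdf.
- apply: ae_eqe_mul2l => /=.
  rewrite Radon_NikodymE//=.
  case: cid => /= h [h1 h2 h3].
  apply: integral_ae_eq => //=.
  + by apply: measurable_funTS; apply/measurable_EFinP; exact: measurable_normal_pdf.
  + by move=> E E01 mE; rewrite -h3.
Qed.

(** The integrability of the powers is to be deduced from this formula, so it cannot be assumed
    here. The truncations min(f, n) are bounded, hence integrable, and monotone convergence removes
    the truncation on both sides. *)
Lemma ge0_integral_normal_prob (f : R -> R) :
  measurable_fun setT f -> (forall x, 0 <= f x) ->
  (\int[gauss]_x (f x)%:E = \int[mu]_x (f x * phi x)%:E)%E.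
Proof.
move=> mf f0; pose t n x : R := Num.min (f x) n%:R.
have mt n : measurable_fun setT (t n) by exact: measurable_minr.
have mEt n : measurable_fun setT (EFin \o t n) by exact/measurable_EFinP.
have t0 n x : 0 <= t n x by rewrite le_min f0/=.
have ndt x n m : (n <= m)%N -> t n x <= t m x.
  move=> nm; rewrite le_min ge_min lexx/= ge_min; apply/orP; right.
  by rewrite ler_nat.
have limt x n : f x <= n%:R -> t n x = f x by move=> ?; exact/min_idPl.
have tint n : gauss.-integrable setT (EFin \o t n).
  apply: measurable_bounded_integrable => //.
    by rewrite (le_lt_trans (probability_le1 _ _))// ltry.
  exact: mt.
  rewrite /bounded_near; near=> y; move=> x _ /=; rewrite ger0_norm//.
  apply: (@le_trans _ _ n%:R); first by rewrite ge_min lexx orbT.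
  by near: y; exact: nbhs_pinfty_ge.
have lim_of (w : R -> R) x : (fun n => (t n x * w x)%:E) @ \oo --> (f x * w x)%:E.
  apply: cvg_near_cst; near=> n; rewrite limt//.
  by near: n; exact: nbhs_infty_ger.
have mphi := measurable_normal_pdf (0 : R) 1.
have phi0 x : 0 <= phi x := normal_pdf_ge0 0 1 x.
have L : (\int[gauss]_x (t n x)%:E)%E @[n --> \oo] --> (\int[gauss]_x (f x)%:E)%E.
  rewrite (_ : \int[gauss]_x (f x)%:E =
      \int[gauss]_x limn (fun n => (t n x)%:E))%E; last first.
    apply: eq_integral => x _; apply/esym/cvg_lim => //.
    by have := lim_of (cst 1) x; under eq_fun do rewrite mulr1; rewrite mulr1.
  apply: cvg_monotone_convergence => //.
  - by move=> n x _; rewrite lee_fin.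
  - by move=> x _ n m nm; rewrite lee_fin ndt.
have mEtphi n : measurable_fun setT (EFin \o (fun x => t n x * phi x)).
  by apply/measurable_EFinP; exact: measurable_funM.
have Rr : (\int[mu]_x (t n x * phi x)%:E)%E @[n --> \oo] -->
    (\int[mu]_x (f x * phi x)%:E)%E.
  rewrite (_ : \int[mu]_x (f x * phi x)%:E =
      \int[mu]_x limn (fun n => (t n x * phi x)%:E))%E; last first.
    by apply: eq_integral => x _; apply/esym/cvg_lim.
  apply: cvg_monotone_convergence => //.
  - by move=> n x _; rewrite lee_fin mulr_ge0.
  - by move=> x _ n m nm; rewrite lee_fin ler_wpM2r// ndt.
rewrite -(cvg_lim _ L)// -(cvg_lim _ Rr)//; congr (limn _).
by apply/funext => n; exact: integrable_integral_normal_prob.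
Unshelve. all: by end_near. Qed.

Lemma integral_normal_prob_even k :
  (\int[gauss]_x (x ^+ k.*2)%:E < +oo)%E /\
  (\int[gauss]_x (x ^+ k.+1.*2)%:E =
   k.*2.+1%:R%:E * \int[gauss]_x (x ^+ k.*2)%:E)%E.
Proof.
have E j : (\int[gauss]_x (x ^+ j.*2)%:E = \int[mu]_x (x ^+ j.*2 * phi x)%:E)%E.
  apply: ge0_integral_normal_prob; first exact: measurable_funX.
  by move=> x; rewrite exprn_even_ge0// odd_double.
by rewrite !E; exact: integral_even_normal_pdf01.
Qed.

Lemma integrable_normal_prob_exprn n : gauss.-integrable setT (fun x => (x ^+ n)%:E).
Proof.
have mX j : measurable_fun setT (fun x : R => x ^+ j) by exact: measurable_funX.
have even k : gauss.-integrable setT (fun x => (x ^+ k.*2)%:E).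
  apply/integrableP; split; first exact/measurable_EFinP.
  under eq_integral do rewrite gee0_abs ?lee_fin ?exprn_even_ge0 ?odd_double//.
  by case: (integral_normal_prob_even k).
have mEX : measurable_fun setT (EFin \o (fun x : R => x ^+ n)) by exact/measurable_EFinP.
(* The dominating function is 1 + x^(2n), by |u| <= 1 + u^2 at u = x^n. *)
have dominating := integrableD measurableT (even 0%N) (even n).
apply: le_integrable dominating => //= x _.
rewrite lee_fin expr0 -addnn exprD -expr2.
rewrite [leRHS]ger0_norm; last by rewrite addr_ge0 ?sqr_ge0.
rewrite -(real_normK (num_real (x ^+ n))).
by have := sqr_ge0 (`|x ^+ n| - 1); rewrite sqrrB1; have := normr_ge0 (x ^+ n); lra.
Qed.

Lemma ge0_integral_oppr (h : R -> R) : continuous h -> (forall x, 0 <= h x) ->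
  (\int[mu]_x (h (- x))%:E = \int[mu]_x (h x)%:E)%E.
Proof.
have split0 (g : R -> R) : continuous g -> (forall x, 0 <= g x) ->
    (\int[mu]_x (g x)%:E = \int[mu]_(x in `[0%R, +oo[) (g (- x))%:E
      + \int[mu]_(x in `[0%R, +oo[) (g x)%:E)%E.
  move=> cg g0; have mg := continuous_measurable_fun cg.
  have mEg : measurable_fun setT (EFin \o g) by exact/measurable_EFinP.
  rewrite -(@set_itvNyy _ R) (@itv_bndbnd_setU _ _ _ (BRight 0))//.
  rewrite ge0_integral_setU//=; last 3 first.
  - by apply: measurable_funTS; exact: mEg.
  - by move=> x _; rewrite lee_fin.
  - rewrite disj_set2E; apply/eqP; rewrite -subset0 => x [] /=.
    by rewrite !in_itv/= andbT => x0; rewrite ltNge x0.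
  rewrite integral_itv_obnd_cbnd; last by apply: measurable_funTS; exact: mEg.
  congr (_ + _)%E; rewrite -[in LHS]oppr0 ge0_integration_by_substitutionNy//.
  exact: continuous_subspaceT.
move=> ch h0; rewrite [RHS]split0// split0//.
- by rewrite addeC; under [X in (_ + X = _)%E]eq_integral do rewrite opprK.
- by move=> x; apply: continuous_comp; [exact: opp_continuous|exact: ch].
Qed.

(** The negative part of an odd function is the reflection of its positive part [g]. The symmetry of
    [phi] gives both the same integral, and its finiteness makes the difference 0. *)
Lemma integral_normal_prob_odd k : (\int[gauss]_x (x ^+ k.*2.+1)%:E = 0)%E.
Proof.
pose f (x : R) := x ^+ k.*2.+1.
have cf : continuous f by exact: exprn_continuous.
pose g x := Num.max (f x) 0.
have cg : continuous g.
  by move=> x; apply: continuous_max; [exact: cf|exact: cst_continuous].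
have fN x : f (- x) = - f x.
  by rewrite /f exprNn -signr_odd oddS odd_double expr1 mulN1r.
have sym : (\int[gauss]_x (g (- x))%:E = \int[gauss]_x (g x)%:E)%E.
  have cgN : continuous (fun x => g (- x)).
    by move=> x; apply: continuous_comp; [exact: opp_continuous|exact: cg].
  have g0 x : 0 <= g x by rewrite le_max lexx orbT.
  rewrite !ge0_integral_normal_prob//; try exact: continuous_measurable_fun.
  rewrite -(@ge0_integral_oppr (fun x => g x * phi x)).
  - by apply: eq_integral => x _; rewrite !normal_pdf01E sqrrN.
  - move=> x; apply: cvgM; first exact: cg.
    exact: (@continuous_normal_pdf R 0 1 (oner_neq0 R)).
  - by move=> x; rewrite mulr_ge0// normal_pdf_ge0.
have gfin : (\int[gauss]_x (g x)%:E)%E \is a fin_num.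
  apply: integrable_fin_num => //.
  have := integrable_funepos measurableT (integrable_normal_prob_exprn k.*2.+1).
  apply: eq_integrable => // x _.
  by rewrite funeposE -EFin_max.
rewrite integralE (_ : \int[gauss]_x _ = \int[gauss]_x (g x)%:E)%E; last first.
  by apply: eq_integral => x _; rewrite funeposE -EFin_max.
rewrite [X in (_ - X)%E](_ : _ = \int[gauss]_x (g (- x))%:E)%E; last first.
  by apply: eq_integral => x _; rewrite funenegE -EFinN -EFin_max /g fN.
by rewrite sym subee.
Qed.

(** The square of a quadratic polynomial has degree four in each coordinate, so these moments
    suffice for its expectation. *)
Lemma Rintegral_normal_prob_exprn :
  [/\ Rintegral gauss setT (fun x => x ^+ 1) = 0,
      Rintegral gauss setT (fun x => x ^+ 2) = 1,
      Rintegral gauss setT (fun x => x ^+ 3) = 0 &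
      Rintegral gauss setT (fun x => x ^+ 4) = 3].
Proof.
have m2 : (\int[gauss]_x (x ^+ 2)%:E = 1)%E.
  have [_] := integral_normal_prob_even 0; rewrite mul1e => ->.
  under eq_integral do rewrite expr0.
  by rewrite integral_cst// mul1e; exact: probability_setT.
rewrite /Rintegral; split.
- by rewrite (integral_normal_prob_odd 0).
- by rewrite m2.
- by rewrite (integral_normal_prob_odd 1).
- by have [_ ->] := integral_normal_prob_even 1; rewrite m2 mule1.
Qed.

End StandardNormalMoments.

(** * Iterated Gaussian expectations *)

Section GaussianIteratedExpectation.
Context {R : realType}.
Local Notation gauss := (normal_prob (0 : R) 1).
Implicit Types (f g : (nat -> R) -> R) (z : nat -> R).

(** Convertible to the function written inside [gexp], so that [gexpS] holds by computation. *)
Definition scons (x : R) z : nat -> R := fun k => if k is k'.+1 then z k' else x.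

(* Integrability at every level of the iterated integral [gexp N g]; [gexp] is
   linear and monotone only on such functions. *)
Fixpoint gint (N : nat) g : Prop :=
  if N is N'.+1 then
    (forall x, gint N' (fun z => g (scons x z))) /\
    gauss.-integrable setT (fun x => (gexp N' (fun z => g (scons x z)))%:E)
  else True.

Lemma gexpS N g :
  gexp N.+1 g = Rintegral gauss setT (fun x => gexp N (fun z => g (scons x z))).
Proof. by []. Qed.

(** Integrability and the equation must be proved together: outer integrability concerns the inner
    expectations, which the equation one level below rewrites as a sum. *)
Lemma gexpD N f g : gint N f -> gint N g ->
  gint N (fun z => f z + g z) /\
  gexp N (fun z => f z + g z) = gexp N f + gexp N g.
Proof.
elim: N f g => [//|N IHN] f g [f1 f2] [g1 g2].
have E x := IHN _ _ (f1 x) (g1 x).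
have fgE : (fun x => gexp N (fun z => f (scons x z) + g (scons x z))) =
    (fun x => gexp N (fun z => f (scons x z)) + gexp N (fun z => g (scons x z))).
  by apply/funext => x; case: (E x).
split; last by rewrite !gexpS fgE RintegralD.
split=> [x|]; first by case: (E x).
apply: eq_integrable (integrableD measurableT f2 g2) => // x _ /=.
by rewrite -EFinD; congr EFin; rewrite -(congr1 (@^~ x) fgE).
Qed.

Lemma gexpZ N a g : gint N g ->
  gint N (fun z => a * g z) /\ gexp N (fun z => a * g z) = a * gexp N g.
Proof.
elim: N g => [//|N IHN] g [g1 g2].
have E x := IHN _ (g1 x).
have gE : (fun x => gexp N (fun z => a * g (scons x z))) =
    (fun x => a * gexp N (fun z => g (scons x z))).
  by apply/funext => x; case: (E x).
split; last by rewrite !gexpS gE RintegralZl.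
split=> [x|]; first by case: (E x).
apply: eq_integrable (integrableZl measurableT a g2) => // x _ /=.
by rewrite -EFinM; congr EFin; rewrite -(congr1 (@^~ x) gE).
Qed.

Lemma gexp_cst N (a : R) : gint N (fun=> a) /\ gexp N (fun=> a) = a.
Proof.
elim: N => [//|N [IH1 IH2]]; rewrite gexpS /= IH2; split.
  by split=> //; exact: finite_measure_integrable_cst.
by rewrite Rintegral_cst//= probability_setT mulr1.
Qed.

Lemma le_gexp N f g : gint N f -> gint N g -> (forall z, f z <= g z) ->
  gexp N f <= gexp N g.
Proof.
elim: N f g => [|N IHN] f g; first by move=> _ _; exact.
move=> [f1 f2] [g1 g2] fg.
rewrite !gexpS; apply: le_Rintegral => // x _.
by apply: IHN; [exact: f1|exact: g1|move=> z; exact: fg].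
Qed.

Lemma Rintegral_gauss_poly4 (a0 a1 a2 a3 a4 : R) :
  let p x := a0 + a1 * x ^+ 1 + a2 * x ^+ 2 + a3 * x ^+ 3 + a4 * x ^+ 4 in
  gauss.-integrable setT (EFin \o p) /\
  Rintegral gauss setT p = a0 + a2 + 3 * a4.
Proof.
have iX (b : R) k : gauss.-integrable setT (EFin \o (fun x => b * x ^+ k)).
  apply: eq_integrable (integrableZl measurableT b (@integrable_normal_prob_exprn R k)) => //.
have i0 : gauss.-integrable setT (EFin \o (fun=> a0)).
  exact: finite_measure_integrable_cst.
have iD (u v : R -> R) : gauss.-integrable setT (EFin \o u) ->
    gauss.-integrable setT (EFin \o v) ->
    gauss.-integrable setT (EFin \o (fun x => u x + v x)).
  by move=> iu iv; apply: eq_integrable (integrableD measurableT iu iv).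
have i1 := iD _ _ i0 (iX a1 1%N).
have i2 := iD _ _ i1 (iX a2 2%N).
have i3 := iD _ _ i2 (iX a3 3%N).
have i4 := iD _ _ i3 (iX a4 4%N).
move=> p; split; first exact: i4.
rewrite /p !RintegralD//.
have iX1 k : gauss.-integrable setT (EFin \o (fun x => x ^+ k)).
  exact: integrable_normal_prob_exprn.
rewrite Rintegral_cst// [X in fine X]probability_setT !RintegralZl//.
have [-> -> -> ->] := @Rintegral_normal_prob_exprn R.
rewrite /=; lra.
Qed.

Definition qform N (c : R) (l : nat -> R) (Q : nat -> nat -> R) z : R :=
  c + \sum_(i < N) l i * z i + \sum_(i < N) \sum_(j < N) Q i j * (z i * z j).

(** Fixing the first coordinate leaves a quadratic polynomial in the others, with coefficients
    depending on [x]. This closure is what lets the second moment be computed by induction on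
    [N]. *)
Lemma qform_scons N c l Q x z : qform N.+1 c l Q (scons x z) =
  qform N (c + l 0%N * x + Q 0%N 0%N * x ^+ 2)
    (fun k => l k.+1 + x * (Q 0%N k.+1 + Q k.+1 0%N))
    (fun i j => Q i.+1 j.+1) z.
Proof.
rewrite /qform !big_ord_recl/=.
under [X in _ + (_ + X)]eq_bigr do rewrite big_ord_recl/=.
rewrite big_split/=.
under [in RHS]eq_bigr do rewrite mulrDl mulrDr mulrDl.
rewrite big_split/= big_split/=.
have -> : \sum_(i < N) Q 0%N (bump 0 i) * (x * z i) =
    \sum_(i < N) x * Q 0%N i.+1 * z i.
  by apply: eq_bigr => i _; rewrite /bump/= add1n; ring.
have -> : \sum_(i < N) Q (bump 0 i) 0%N * (z i * x) =
    \sum_(i < N) x * Q i.+1 0%N * z i.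
  by apply: eq_bigr => i _; rewrite /bump/= add1n; ring.
have -> : \sum_(i < N) l (bump 0 i) * z i = \sum_(i < N) l i.+1 * z i.
  by apply: eq_bigr => i _; rewrite /bump/= add1n.
have -> : \sum_(i < N) \sum_(j < N) Q (bump 0 i) (bump 0 j) * (z i * z j) =
    \sum_(i < N) \sum_(j < N) Q i.+1 j.+1 * (z i * z j).
  by apply: eq_bigr => i _; apply: eq_bigr => j _; rewrite /bump/= !add1n.
ring.
Qed.

(** Squared mean plus variance. [Q] need not be symmetric, hence the pairing of [Q i j] with
    [Q j i]. *)
Definition qsqr N (c : R) (l : nat -> R) (Q : nat -> nat -> R) : R :=
  (c + \sum_(i < N) Q i i) ^+ 2 + \sum_(i < N) l i ^+ 2
  + \sum_(i < N) \sum_(j < N) Q i j * (Q i j + Q j i).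

Lemma gexp_qform_sqr N c l Q :
  gint N (fun z => qform N c l Q z ^+ 2) /\
  gexp N (fun z => qform N c l Q z ^+ 2) = qsqr N c l Q.
Proof.
elim: N c l Q => [|N IHN] c l Q.
  by split=> //=; rewrite /qform /qsqr !big_ord0 !addr0.
pose s k := Q 0%N k.+1 + Q k.+1 0%N.
pose Q' i j := Q i.+1 j.+1.
pose C := c + \sum_(i < N) Q' i i.
pose W := \sum_(i < N) \sum_(j < N) Q' i j * (Q' i j + Q' j i).
pose q := Q 0%N 0%N.
(* By induction the inner second moment is a quartic in the first coordinate, with coefficients [a0]
   to [a4]. Integration leaves a0 + a2 + 3 a4; of the 3 q^2, one q^2 completes the square (C + q)^2
   and the other two are the diagonal term of the variance. *)
pose a0 := C ^+ 2 + \sum_(i < N) l i.+1 ^+ 2 + W.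
pose a1 := 2 * C * l 0%N + 2 * \sum_(i < N) l i.+1 * s i.
pose a2 := l 0%N ^+ 2 + 2 * C * q + \sum_(i < N) s i ^+ 2.
pose a3 := 2 * l 0%N * q.
pose a4 := q ^+ 2.
have E x : gint N (fun z => qform N.+1 c l Q (scons x z) ^+ 2) /\
    gexp N (fun z => qform N.+1 c l Q (scons x z) ^+ 2) =
    a0 + a1 * x ^+ 1 + a2 * x ^+ 2 + a3 * x ^+ 3 + a4 * x ^+ 4.
  under eq_fun do rewrite qform_scons.
  have [I ->] := IHN (c + l 0%N * x + q * x ^+ 2) (fun k => l k.+1 + x * s k) Q'.
  split=> //; rewrite /qsqr -/W.
  have -> : \sum_(i < N) (l i.+1 + x * s i) ^+ 2 = \sum_(i < N) l i.+1 ^+ 2 +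
     2 * x * (\sum_(i < N) l i.+1 * s i) + x ^+ 2 * \sum_(i < N) s i ^+ 2.
    rewrite !mulr_sumr -!big_split/=; apply: eq_bigr => i _; ring.
  rewrite /a0 /a1 /a2 /a3 /a4 /C; ring.
have EE : (fun x => gexp N (fun z => qform N.+1 c l Q (scons x z) ^+ 2)) =
    (fun x => a0 + a1 * x ^+ 1 + a2 * x ^+ 2 + a3 * x ^+ 3 + a4 * x ^+ 4).
  by apply/funext => x; case: (E x).
have [pint pE] := Rintegral_gauss_poly4 a0 a1 a2 a3 a4.
rewrite gexpS EE pE; split.
  split=> [x|]; first by case: (E x).
  by apply: eq_integrable pint => // x _; rewrite /= -(congr1 (@^~ x) EE).
rewrite /qsqr !big_ord_recl/=.
under [X in _ = _ + (_ + X)]eq_bigr do rewrite big_ord_recl/=.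
rewrite big_split/=.
have b1 (i : nat) : bump 0 i = i.+1 by rewrite /bump/= add1n.
have -> : \sum_(i < N) l (bump 0 i) ^+ 2 = \sum_(i < N) l i.+1 ^+ 2.
  by apply: eq_bigr => i _; rewrite b1.
have -> : \sum_(i < N) \sum_(j < N) Q (bump 0 i) (bump 0 j) *
    (Q (bump 0 i) (bump 0 j) + Q (bump 0 j) (bump 0 i)) = W.
  by apply: eq_bigr => i _; apply: eq_bigr => j _; rewrite !b1.
have -> : \sum_(i < N) Q i.+1 i.+1 = \sum_(i < N) Q' i i by [].
have sE : \sum_(i < N) s i ^+ 2 =
    \sum_(i < N) Q 0%N (bump 0 i) * (Q 0%N (bump 0 i) + Q (bump 0 i) 0%N) +
    \sum_(i < N) Q (bump 0 i) 0%N * (Q (bump 0 i) 0%N + Q 0%N (bump 0 i)).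
  by rewrite -big_split/=; apply: eq_bigr => i _; rewrite !b1 /s; ring.
by rewrite /a0 /a2 /a4 sE /C /q; ring.
Qed.

(* Measurability of [G] along every measurable parametrization of its arguments:
   this avoids putting a sigma-algebra on [nat -> R]. *)
Definition measurable_stream_fun d (T : measurableType d)
    (G : T -> (nat -> R) -> R) : Prop :=
  forall d' (S : measurableType d') (tau : S -> T) (zeta : S -> nat -> R),
    measurable_fun setT tau ->
    (forall k, measurable_fun setT (fun s => zeta s k)) ->
    measurable_fun setT (fun s => G (tau s) (zeta s)).

Arguments measurable_stream_fun {d T} G.

Lemma measurable_stream_fun_scons d (T : measurableType d) (G : T -> (nat -> R) -> R) :
  measurable_stream_fun G ->
  measurable_stream_fun (fun (p : T * measurableTypeR R) z => G p.1 (scons p.2 z)).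
Proof.
move=> mG d' S tau zeta mtau mzeta.
apply: (mG _ S (fst \o tau) (fun s => scons (tau s).2 (zeta s))).
  exact: measurableT_comp.
by case=> [|k] /=; [exact: measurableT_comp|exact: mzeta].
Qed.

(** Tonelli applied separately to the positive and negative parts, so that measurability is
    available before any integrability is known. *)
Lemma measurable_fun_Rintegral d (T : measurableType d) (F : T * measurableTypeR R -> R) :
  measurable_fun setT F ->
  measurable_fun setT (fun t => Rintegral gauss setT (fun x => F (t, x))).
Proof.
move=> mF; rewrite /Rintegral; apply: measurableT_comp => //.
under eq_fun do rewrite integralE.
have mEF : measurable_fun setT (EFin \o F) by exact/measurable_EFinP.
apply: emeasurable_funB.
- rewrite (_ : (fun _ => _) = fubini_F gauss ((EFin \o F)^\+)%E); last first.
    by apply/funext => t; apply: eq_integral => x _; rewrite !funeposE.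
  exact: measurable_fun_fubini_tonelli_F (measurable_funepos mEF) (funepos_ge0 _).
- rewrite (_ : (fun _ => _) = fubini_F gauss ((EFin \o F)^\-)%E); last first.
    by apply/funext => t; apply: eq_integral => x _; rewrite !funenegE.
  exact: measurable_fun_fubini_tonelli_F (measurable_funeneg mEF) (funeneg_ge0 _).
Qed.

(** Each step moves the coordinate being integrated into the parameter, replacing [T] by its product
    with the line; the induction therefore ranges over all parameter spaces. *)
Lemma measurable_gexp N d (T : measurableType d) (G : T -> (nat -> R) -> R) :
  measurable_stream_fun G -> measurable_fun setT (fun t => gexp N (G t)).
Proof.
elim: N d T G => [|N IHN] d T G mG.
  exact: (mG _ T id (fun _ _ => 0)).
have mG' := IHN _ _ _ (measurable_stream_fun_scons _ _ _ mG).
exact: (measurable_fun_Rintegral _ _ _ mG').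
Qed.

(** Supplies [gint] for integrands built from [Phi], which are bounded but not polynomial. The bound
    on the inner expectations is what makes the outer function integrable, so it is part of the
    induction. *)
Lemma gint_bounded N d (T : measurableType d) (G : T -> (nat -> R) -> R) (C : R) :
  measurable_stream_fun G -> (forall t z, `|G t z| <= C) ->
  forall t, gint N (G t) /\ `|gexp N (G t)| <= C.
Proof.
elim: N d T G => [|N IHN] d T G mG GC t; first by split=> //; exact: GC.
have mG' := measurable_stream_fun_scons _ _ _ mG.
have bnd x := IHN _ _ _ mG' (fun p z => GC p.1 (scons p.2 z)) (t, x).
have mf : measurable_fun setT (fun x => gexp N (fun z => G t (scons x z))).
  exact: (measurableT_comp (measurable_gexp N _ _ _ mG') (pair1_measurable t)).
have intf : gauss.-integrable setT (EFin \o (fun x => gexp N (fun z => G t (scons x z)))).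
  apply: measurable_bounded_integrable => //.
    by rewrite (le_lt_trans (probability_le1 _ _))// ltry.
  rewrite /bounded_near; near=> M; move=> x _ /=.
  apply: (@le_trans _ _ C); first by case: (bnd x).
  by near: M; apply: nbhs_pinfty_ge; exact: num_real.
split; first by split=> // x; case: (bnd x).
rewrite gexpS; apply: le_trans (le_normr_Rintegral _ intf) _ => //.
have <- : Rintegral gauss setT (fun=> C) = C.
  by rewrite Rintegral_cst// [X in fine X]probability_setT mulr1.
have intC : gauss.-integrable setT (EFin \o (fun=> C)).
  exact: finite_measure_integrable_cst.
by apply: (le_Rintegral measurableT (integrable_norm intf) intC) => x _; case: (bnd x).
Unshelve. all: by end_near. Qed.

Lemma gexp_dist_le N g h (v : R) : gint N g -> gint N h ->
  (forall z, `|g z - v| <= h z) -> `|gexp N g - v| <= gexp N h.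
Proof.
move=> ig ih gh; have [iv Ev] := gexp_cst N v.
have [ivh Evh] := gexpD _ _ _ iv ih; have [igh Egh] := gexpD _ _ _ ig ih.
have le1 : gexp N g <= v + gexp N h.
  rewrite -[in leRHS]Ev -Evh; apply: le_gexp => // z.
  by have := gh z; rewrite ler_norml => /andP[]; lra.
have le2 : v <= gexp N g + gexp N h.
  rewrite -[in leLHS]Ev -Egh; apply: le_gexp => // z.
  by have := gh z; rewrite ler_norml => /andP[]; lra.
by rewrite ler_norml; apply/andP; split; lra.
Qed.

End GaussianIteratedExpectation.
Arguments measurable_stream_fun {R d T} G.

(** * The normal distribution function *)

Section StandardNormalCDF.
Context {R : realType}.
Local Notation mu := (@lebesgue_measure R).
Local Notation gauss := (normal_prob (0 : R) 1).

Lemma PhiE (x : R) : (Phi x)%:E = gauss `]-oo, x].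
Proof.
rewrite /Phi /Rintegral -[[set y | y <= x]]set_itvNyc fineK//.
exact: (fin_num_measure gauss).
Qed.

Lemma Phi_ge0 (x : R) : 0 <= Phi x.
Proof. by rewrite -lee_fin PhiE; exact: measure_ge0. Qed.

Lemma Phi_le1 (x : R) : Phi x <= 1.
Proof. by rewrite -lee_fin PhiE; exact: (probability_le1 gauss). Qed.

(** The density is at most its peak, so [Phi] is Lipschitz with that constant. *)
Lemma Phi_increment (x y : R) : x <= y ->
  0 <= Phi y - Phi x <= normal_peak 1 * (y - x).
Proof.
move=> xy.
have E : (Phi y)%:E = ((Phi x)%:E + gauss `]x, y])%E.
  rewrite !PhiE -measureU//.
  - by rewrite -itv_bndbnd_setU.
  - rewrite -subset0 => u [] /=; rewrite !in_itv/= => ux /andP[xu _].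
    by move: xu; rewrite ltNge ux.
have g0 : (0 <= gauss `]x, y])%E by exact: measure_ge0.
have gle : (gauss `]x, y] <= (normal_peak 1 * (y - x))%:E)%E.
  apply: (@le_trans _ _ (\int[mu]_(u in `]x, y]) (normal_peak 1)%:E)%E).
    apply: ge0_le_integral => //.
    - by move=> u _; rewrite lee_fin normal_pdf_ge0.
    - by apply: measurable_funTS; apply/measurable_EFinP; exact: measurable_normal_pdf.
    - by move=> u _; rewrite lee_fin normal_pdf_ub// oner_neq0.
  rewrite integral_cst//= lebesgue_measure_itv/= lte_fin.
  case: ltP => [_|yx]; first by rewrite -EFinD -EFinM.
  by rewrite mule0 lee_fin mulr_ge0 ?normal_peak_ge0// subr_ge0.
have : (gauss `]x, y] = (Phi y - Phi x)%:E)%E by rewrite EFinB E addeAC subee// add0e.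
by move=> gE; move: g0 gle; rewrite gE !lee_fin => -> ->.
Qed.

Lemma continuous_Phi : continuous (@Phi R).
Proof.
have peak0 : 0 < normal_peak (1 : R) by rewrite normal_peak_gt0// oner_neq0.
have lip (x y : R) : `|Phi x - Phi y| <= normal_peak 1 * `|x - y|.
  wlog xy : x y / y <= x.
    move=> h; case: (leP y x) => [/h//|/ltW /h]; by rewrite distrC (distrC y).
  have /andP[le0 le1] := Phi_increment _ _ xy.
  by rewrite !ger0_norm// subr_ge0.
move=> x; apply/cvgrPdist_le => e e0; near=> y.
apply: le_trans (lip _ _) _; rewrite -ler_pdivlMl//.
near: y; have /cvgrPdist_le : (fun y : R => y) y @[y --> x] --> x by exact: cvg_id.
apply.
by rewrite mulr_gt0// invr_gt0.
Unshelve. all: by end_near. Qed.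

End StandardNormalCDF.

(** * Bilinear block forms in the Gaussian coordinates *)

Section BlockSums.
Context {R : realType}.

Lemma big_block p M (f : nat -> R) :
  \sum_(k < p * M) f k = \sum_(b < M) \sum_(r < p) f (b * p + r)%N.
Proof.
elim: M => [|M IHM]; first by rewrite muln0 !big_ord0.
rewrite big_ord_recr/= -IHM -!(big_mkord xpredT) mulnSr.
rewrite (@big_cat_nat _ _ _ (p * M)%N)//= ?leq_addr//; congr (_ + _).
rewrite -[X in \sum_(X <= _ < _) _]add0n big_addn addKn big_mkord.
by apply: eq_bigr => r _; rewrite addnC mulnC.
Qed.

Lemma big_block2 p M (f : nat -> nat -> R) :
  \sum_(k < p * M) \sum_(k' < p * M) f k k' =
  \sum_(b < M) \sum_(b' < M) \sum_(r < p) \sum_(r' < p)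
    f (b * p + r)%N (b' * p + r')%N.
Proof.
rewrite (big_block p M (fun k => \sum_(k' < p * M) f k k')).
apply: eq_bigr => b _; under eq_bigr => r _ do rewrite (big_block p M (f (b * p + r)%N)).
by rewrite exchange_big.
Qed.

Lemma sum_delta p (x : R) (g : nat -> R) (r : 'I_p) :
  \sum_(r' < p) (r == r' :> nat)%:R * (x * g r') = x * g r.
Proof.
rewrite (bigD1 r)//= eqxx mul1r big1 ?addr0// => r' r'r.
by rewrite -val_eqE in r'r; rewrite eq_sym (negbTE r'r) mul0r.
Qed.

Variables (p M : nat) (d alpha beta : nat -> R) (kappa : R).

Let rowsum (w : nat -> R) (z : nat -> R) r := \sum_(b < M) w b * z (b * p + r)%N.

(** Inner product of kappa d plus noise with d plus noise, where both noises combine the same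
    Gaussian blocks, with weights [alpha] and [beta] common to all coordinates. *)
Definition block_form z : R := \sum_(r < p)
  (kappa * d r + rowsum alpha z r) * (d r + rowsum beta z r).

Let lin k := d (k %% p)%N * (kappa * beta (k %/ p)%N + alpha (k %/ p)%N).
(** Kronecker product of the rank-one matrix alpha beta^T with the identity of size [p]: [k %/ p] is
    the block and [k %% p] the coordinate. *)
Let quadr k k' := (k %% p == k' %% p)%N%:R * (alpha (k %/ p)%N * beta (k' %/ p)%N).

Let blockE b r : (r < p)%N -> ((b * p + r) %/ p = b)%N /\ ((b * p + r) %% p = r)%N.
Proof.
move=> rp; have p0 : (0 < p)%N by exact: leq_ltn_trans rp.
by rewrite modnMDl modn_small// divnMDl// divn_small// addn0.
Qed.

Let linE b (r : 'I_p) : lin (b * p + r)%N = d r * (kappa * beta b + alpha b).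
Proof. by rewrite /lin; have [-> ->] := blockE b r (ltn_ord r). Qed.

Let quadrE b (r : 'I_p) b' (r' : 'I_p) :
  quadr (b * p + r)%N (b' * p + r')%N = (r == r' :> nat)%:R * (alpha b * beta b').
Proof.
rewrite /quadr; have [-> ->] := blockE b r (ltn_ord r).
by have [-> ->] := blockE b' r' (ltn_ord r').
Qed.

Lemma block_formE m z :
  block_form z - m = qform (p * M) (kappa * (\sum_(r < p) d r ^+ 2) - m) lin quadr z.
Proof.
rewrite /qform (big_block p M (fun k => lin k * z k)).
rewrite (big_block2 p M (fun k k' => quadr k k' * (z k * z k'))).
have -> : block_form z = kappa * (\sum_(r < p) d r ^+ 2) +
    \sum_(r < p) d r * (kappa * rowsum beta z r + rowsum alpha z r) +
    \sum_(r < p) rowsum alpha z r * rowsum beta z r.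
  by rewrite mulr_sumr -!big_split/=; apply: eq_bigr => r _; ring.
rewrite -!addrA [RHS]addrCA [- m + _]addrC -!addrA; congr (_ + _).
have -> : \sum_(r < p) d r * (kappa * rowsum beta z r + rowsum alpha z r) =
    \sum_(b < M) \sum_(r < p) lin (b * p + r) * z (b * p + r)%N.
  rewrite exchange_big/=; apply: eq_bigr => r _.
  rewrite /rowsum mulr_sumr -big_split/= mulr_sumr; apply: eq_bigr => b _.
  by rewrite linE; ring.
have -> : \sum_(r < p) rowsum alpha z r * rowsum beta z r =
   \sum_(b < M) \sum_(b' < M) \sum_(r < p) \sum_(r' < p)
    quadr (b * p + r) (b' * p + r') * (z (b * p + r)%N * z (b' * p + r')%N).
  under [RHS]eq_bigr do rewrite exchange_big.
  rewrite [RHS]exchange_big/=; apply: eq_bigr => r _.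
  rewrite /rowsum big_distrlr/=; apply: eq_bigr => b _; apply: eq_bigr => b' _.
  transitivity (\sum_(r' < p) (r == r' :> nat)%:R *
      (alpha b * z (b * p + r)%N * beta b' * z (b' * p + r')%N)).
    by rewrite (sum_delta _ _ (fun r' => z (b' * p + r')%N)); ring.
  by apply: eq_bigr => r' _; rewrite quadrE; ring.
ring.
Qed.

(** For the Kronecker matrix Q, the trace is p <alpha, beta>, the sum of Q_ij^2 is p |alpha|^2
    |beta|^2, and the sum of Q_ij Q_ji is p <alpha, beta>^2. *)
Lemma qsqr_block c :
  qsqr (p * M) c lin quadr =
    (c + p%:R * \sum_(b < M) alpha b * beta b) ^+ 2
  + (\sum_(r < p) d r ^+ 2) * (\sum_(b < M) (kappa * beta b + alpha b) ^+ 2)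
  + p%:R * ((\sum_(b < M) alpha b ^+ 2) * (\sum_(b < M) beta b ^+ 2)
            + (\sum_(b < M) alpha b * beta b) ^+ 2).
Proof.
rewrite /qsqr (big_block _ _ (fun k => quadr k k)) (big_block _ _ (fun k => lin k ^+ 2)).
rewrite (big_block2 _ _ (fun k k' => quadr k k' * (quadr k k' + quadr k' k))).
congr (_ ^+ 2 + _ + _).
- congr (_ + _); rewrite mulr_sumr; apply: eq_bigr => b _.
  under eq_bigr do rewrite quadrE eqxx mul1r.
  by rewrite sumr_const card_ord mulr_natl.
- rewrite exchange_big/= mulr_suml; apply: eq_bigr => r _; rewrite mulr_sumr.
  by apply: eq_bigr => b _; rewrite linE exprMn.
- transitivity (\sum_(b < M) \sum_(b' < M) p%:R * (alpha b ^+ 2 * beta b' ^+ 2 +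
      alpha b * beta b * (alpha b' * beta b'))).
    apply: eq_bigr => b _; apply: eq_bigr => b' _.
    transitivity (\sum_(r < p) (alpha b ^+ 2 * beta b' ^+ 2 +
      alpha b * beta b * (alpha b' * beta b'))); last first.
      by rewrite sumr_const card_ord mulr_natl.
    apply: eq_bigr => r _.
    rewrite -[RHS]mulr1 -(sum_delta _ _ (fun=> 1) r); apply: eq_bigr => r' _.
    rewrite !quadrE [_ == r :> nat]eq_sym; case: (_ == _) => /=; ring.
  under eq_bigr do rewrite -mulr_sumr big_split/= -mulr_sumr -mulr_sumr.
  by rewrite -mulr_sumr big_split/= -!mulr_suml expr2.
Qed.

Lemma gexp_block_form m :
  gint (p * M) (fun z => (block_form z - m) ^+ 2) /\
  gexp (p * M) (fun z => (block_form z - m) ^+ 2) =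
    (kappa * (\sum_(r < p) d r ^+ 2) - m + p%:R * \sum_(b < M) alpha b * beta b) ^+ 2
  + (\sum_(r < p) d r ^+ 2) * (\sum_(b < M) (kappa * beta b + alpha b) ^+ 2)
  + p%:R * ((\sum_(b < M) alpha b ^+ 2) * (\sum_(b < M) beta b ^+ 2)
            + (\sum_(b < M) alpha b * beta b) ^+ 2).
Proof.
under eq_fun do rewrite block_formE.
by rewrite -qsqr_block; exact: gexp_qform_sqr.
Qed.

Lemma measurable_block_form dS (S : measurableType dS) (zeta : S -> nat -> R) :
  (forall k, measurable_fun setT (fun s => zeta s k)) ->
  measurable_fun setT (fun s => block_form (zeta s)).
Proof.
move=> mz.
have mrow w r : measurable_fun setT (fun s => rowsum w (zeta s) r).
  by apply: measurable_sum => b; apply: measurable_funM.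
by apply: measurable_sum => r; apply: measurable_funM; apply: measurable_funD.
Qed.

End BlockSums.

(** * Whitening by the factor [L], and the noise of the sample means *)

Section Whitening.
Context {R : realType}.

(** A nonzero row vector annihilated by [L] would be isotropic for [Sigma]. *)
Lemma factor_unitmx p (Sigma L : 'M[R]_p) :
  (forall v : 'cV[R]_p, v != 0 -> 0 < (v^T *m Sigma *m v) 0 0) ->
  L *m L^T = Sigma -> L \in unitmx.
Proof.
move=> posS LS; rewrite unitmxE unitfE; apply/negP => /det0P[v v0 vL].
have vT0 : v^T != 0 by rewrite -(inj_eq (@trmx_inj _ _ _)) trmxK trmx0.
by have := posS _ vT0; rewrite trmxK -LS mulmxA vL !mul0mx mxE ltxx.
Qed.

Lemma quad_factor p (Sigma L : 'M[R]_p) (x y : 'cV[R]_p) :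
  L \in unitmx -> L *m L^T = Sigma ->
  quad Sigma (L *m x) (L *m y) = \sum_(r < p) x r 0 * y r 0.
Proof.
move=> uL LS; have uS : Sigma \in unitmx by rewrite -LS unitmx_mul unitmx_tr uL.
have key : L^T *m invmx Sigma *m L = 1%:M.
  by apply: (can_inj (mulKmx uL)); rewrite !mulmxA LS mulmxV// mul1mx mulmx1.
rewrite /quad trmx_mul !mulmxA -(mulmxA x^T L^T) -(mulmxA x^T _ L) key mulmx1.
by rewrite mxE; apply: eq_bigr => r _; rewrite mxE.
Qed.

(* Weights of the blocks of z in the whitened deviations of the two sample means
   from the prior means, following the block layout of [xbar]. *)
Definition wt0 (n0 : nat) (nu0 : R) (b : nat) : R :=
  if b == 0%N then (Num.sqrt nu0)^-1
  else if (1 < b < 2 + n0)%N then n0%:R^-1 else 0.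

Definition wt1 (n0 n1 : nat) (nu1 : R) (b : nat) : R :=
  if b == 1%N then (Num.sqrt nu1)^-1
  else if (2 + n0 <= b)%N then n1%:R^-1 else 0.

Lemma sum_sample_blocks n0 n1 (f : nat -> R) :
  \sum_(b < 2 + n0 + n1) f b = f 0%N + f 1%N
    + \sum_(j < n0) f (2 + j)%N + \sum_(j < n1) f (2 + n0 + j)%N.
Proof. by rewrite !big_split_ord/= 2!big_ord_recl big_ord0 addr0. Qed.

Lemma sum_wt0 n0 n1 nu0 (f : nat -> R) :
  \sum_(b < 2 + n0 + n1) wt0 n0 nu0 b * f b =
  (Num.sqrt nu0)^-1 * f 0%N + n0%:R^-1 * \sum_(j < n0) f (2 + j)%N.
Proof.
rewrite (sum_sample_blocks n0 n1 (fun b => wt0 n0 nu0 b * f b)) mulr_sumr.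
rewrite /wt0/= mul0r addr0 [X in _ + X]big1 ?addr0; last first.
  by move=> j _; case: ifP; rewrite ?mul0r// ltnNge leq_addr.
by congr (_ + _); apply: eq_bigr => j _; rewrite ltn_add2l ltn_ord.
Qed.

Lemma sum_wt1 n0 n1 nu1 (f : nat -> R) :
  \sum_(b < 2 + n0 + n1) wt1 n0 n1 nu1 b * f b =
  (Num.sqrt nu1)^-1 * f 1%N + n1%:R^-1 * \sum_(j < n1) f (2 + n0 + j)%N.
Proof.
rewrite (sum_sample_blocks n0 n1 (fun b => wt1 n0 n1 nu1 b * f b)) mulr_sumr.
rewrite /wt1/= mul0r add0r [X in _ + X + _]big1 ?addr0; last first.
  by move=> j _; rewrite leqNgt ltn_add2l ltn_ord mul0r.
by congr (_ + _); apply: eq_bigr => j _; rewrite leq_addr.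
Qed.

(** The variance of one whitened coordinate of the class-0 sample mean: the prior gives 1/nu0, and
    n0 blocks of weight 1/n0 give n0/n0^2. *)
Lemma sum_wt0_sqr n0 n1 nu0 : (0 < n0)%N -> 0 < nu0 ->
  \sum_(b < 2 + n0 + n1) wt0 n0 nu0 b ^+ 2 = nu0^-1 + n0%:R^-1.
Proof.
move=> n00 nu00; under eq_bigr do rewrite expr2.
rewrite (sum_wt0 n0 n1 nu0 (wt0 n0 nu0)) /wt0/= -expr2 exprVn sqr_sqrtr ?ltW//.
congr (_ + _); under eq_bigr do rewrite ltn_add2l ltn_ord.
by rewrite sumr_const card_ord -(mulr_natl _^-1) mulfV ?mulr1// pnatr_eq0 -lt0n.
Qed.

Lemma sum_wt1_sqr n0 n1 nu1 : (0 < n1)%N -> 0 < nu1 ->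
  \sum_(b < 2 + n0 + n1) wt1 n0 n1 nu1 b ^+ 2 = nu1^-1 + n1%:R^-1.
Proof.
move=> n10 nu10; under eq_bigr do rewrite expr2.
rewrite (sum_wt1 n0 n1 nu1 (wt1 n0 n1 nu1)) /wt1/= -expr2 exprVn sqr_sqrtr ?ltW//.
congr (_ + _); under eq_bigr do rewrite leq_addr.
by rewrite sumr_const card_ord -(mulr_natl _^-1) mulfV ?mulr1// pnatr_eq0 -lt0n.
Qed.

(** The weights live on disjoint sets of blocks; this expresses the independence of the two classes
    and removes the cross terms in [sum_wt_comb]. *)
Lemma sum_wt0_wt1 n0 n1 nu0 nu1 :
  \sum_(b < 2 + n0 + n1) wt0 n0 nu0 b * wt1 n0 n1 nu1 b = 0.
Proof.
rewrite (sum_wt0 n0 n1 nu0 (wt1 n0 n1 nu1)) /wt1/= mulr0 add0r big1 ?mulr0//.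
by move=> j _; rewrite leqNgt ltn_add2l ltn_ord.
Qed.

Lemma sum_wt_comb n0 n1 nu0 nu1 (e0 e1 f0 f1 : R) :
  (0 < n0)%N -> (0 < n1)%N -> 0 < nu0 -> 0 < nu1 ->
  \sum_(b < 2 + n0 + n1) (e0 * wt0 n0 nu0 b + e1 * wt1 n0 n1 nu1 b) *
    (f0 * wt0 n0 nu0 b + f1 * wt1 n0 n1 nu1 b) =
  e0 * f0 * (nu0^-1 + n0%:R^-1) + e1 * f1 * (nu1^-1 + n1%:R^-1).
Proof.
move=> n00 n10 nu00 nu10.
rewrite -(sum_wt0_sqr n0 n1)// -(sum_wt1_sqr n0 n1)//.
have cross : (e0 * f1 + e1 * f0) *
    (\sum_(b < 2 + n0 + n1) wt0 n0 nu0 b * wt1 n0 n1 nu1 b) = 0.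
  by rewrite sum_wt0_wt1 mulr0.
rewrite -[RHS]addr0 -[X in _ = _ + X]cross.
by rewrite !mulr_sumr -!big_split/=; apply: eq_bigr => b _; ring.
Qed.

Definition noise p M (w : nat -> R) (z : nat -> R) : 'cV[R]_p :=
  \col_(r < p) \sum_(b < M) w b * z (b * p + r)%N.

Lemma xbar0E p (L : 'M[R]_p) m0 m1 n0 n1 nu0 nu1 z :
  L \in unitmx -> (0 < n0)%N ->
  xbar L m0 m1 n0 n1 nu0 nu1 z false =
  L *m (invmx L *m m0 + noise p (2 + n0 + n1) (wt0 n0 nu0) z).
Proof.
move=> uL n00; have n0R : n0%:R != 0 :> R by rewrite pnatr_eq0 -lt0n.
have -> : noise p (2 + n0 + n1) (wt0 n0 nu0) z =
    (Num.sqrt nu0)^-1 *: blk p z 0 + n0%:R^-1 *: \sum_(j < n0) blk p z (2 + j)%N.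
  apply/matrixP => r j; rewrite !mxE (sum_wt0 n0 n1 nu0 (fun b => z (b * p + r)%N)).
  by rewrite summxE; congr (_ + _ * _); apply: eq_bigr => k _; rewrite mxE.
rewrite /xbar /mu_rv big_split/= sumr_const card_ord scalerDr -scalerMnr scalerMnl.
rewrite -(mulr_natr _^-1) mulVf// scale1r !mulmxDr mulKVmx// -!scalemxAr addrA; congr (_ + _ *: _).
by rewrite mulmx_sumr.
Qed.

Lemma xbar1E p (L : 'M[R]_p) m0 m1 n0 n1 nu0 nu1 z :
  L \in unitmx -> (0 < n1)%N ->
  xbar L m0 m1 n0 n1 nu0 nu1 z true =
  L *m (invmx L *m m1 + noise p (2 + n0 + n1) (wt1 n0 n1 nu1) z).
Proof.
move=> uL n10; have n1R : n1%:R != 0 :> R by rewrite pnatr_eq0 -lt0n.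
have -> : noise p (2 + n0 + n1) (wt1 n0 n1 nu1) z =
    (Num.sqrt nu1)^-1 *: blk p z 1 + n1%:R^-1 *: \sum_(j < n1) blk p z (2 + n0 + j)%N.
  apply/matrixP => r j; rewrite !mxE (sum_wt1 n0 n1 nu1 (fun b => z (b * p + r)%N)).
  by rewrite summxE; congr (_ + _ * _); apply: eq_bigr => k _; rewrite mxE.
rewrite /xbar /mu_rv big_split/= sumr_const card_ord scalerDr -scalerMnr scalerMnl.
rewrite -(mulr_natr _^-1) mulVf// scale1r !mulmxDr mulKVmx// -!scalemxAr addrA; congr (_ + _ *: _).
by rewrite mulmx_sumr.
Qed.
End Whitening.

(** * The squared distance and the discriminant as block forms *)

Section Discriminant.
Context {R : realType}.

(** [block_form] indexes coordinates by natural numbers, so a vector is extended by 0 beyond its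
    dimension. *)
Definition coord p (v : 'cV[R]_p) (r : nat) : R :=
  if insub r is Some i then v i 0 else 0.

Lemma coordE p (v : 'cV[R]_p) (r : 'I_p) : coord p v r = v r 0.
Proof. by rewrite /coord valK. Qed.

(* With (kappa, e0, e1) = (1, 1, -1) this is deltahat^2; with kappa = +-1/2 and
   suitable e0, e1 it is the numerator of the discriminant, see [epsB_iE]. *)
Definition stat p n0 n1 nu0 nu1 (d : 'cV[R]_p) (kappa e0 e1 : R) (z : nat -> R) : R :=
  block_form p (2 + n0 + n1) (coord p d)
    (fun b => e0 * wt0 n0 nu0 b + e1 * wt1 n0 n1 nu1 b)
    (fun b => 1 * wt0 n0 nu0 b + (-1) * wt1 n0 n1 nu1 b) kappa z.

Lemma stat_quad p (Sigma L : 'M[R]_p) n0 n1 nu0 nu1 d kappa e0 e1 z :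
  L \in unitmx -> L *m L^T = Sigma ->
  let N0 := noise p (2 + n0 + n1) (wt0 n0 nu0) z in
  let N1 := noise p (2 + n0 + n1) (wt1 n0 n1 nu1) z in
  stat p n0 n1 nu0 nu1 d kappa e0 e1 z =
  quad Sigma (L *m (kappa *: d + e0 *: N0 + e1 *: N1)) (L *m (d + N0 - N1)).
Proof.
move=> uL LS N0 N1; rewrite (quad_factor _ _ _ _ _ uL LS); apply: eq_bigr => r _.
rewrite coordE !mxE; congr (_ * _); rewrite -!addrA; congr (_ + _).
  by rewrite !mulr_sumr -big_split/=; apply: eq_bigr => b _; ring.
by rewrite -sumrB; apply: eq_bigr => b _; ring.
Qed.

(** The three lines are the squared bias, the variance of the part linear in the noise, and the
    variance of the quadratic part. [D] is the squared Mahalanobis distance of the prior means, and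
    [s0], [s1] are the coordinate variances of the whitened sample means. *)
Definition stat_mse p (D s0 s1 kappa e0 e1 m : R) : R :=
  (kappa * D - m + p%:R * (e0 * s0 - e1 * s1)) ^+ 2
  + D * ((kappa + e0) ^+ 2 * s0 + (e1 - kappa) ^+ 2 * s1)
  + p%:R * ((e0 ^+ 2 * s0 + e1 ^+ 2 * s1) * (s0 + s1) + (e0 * s0 - e1 * s1) ^+ 2).

Lemma gexp_stat p (Sigma L : 'M[R]_p) n0 n1 nu0 nu1 d kappa e0 e1 m :
  L \in unitmx -> L *m L^T = Sigma ->
  (0 < n0)%N -> (0 < n1)%N -> 0 < nu0 -> 0 < nu1 ->
  let sq z := (stat p n0 n1 nu0 nu1 d kappa e0 e1 z - m) ^+ 2 in
  gint (Ndim p n0 n1) sq /\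
  gexp (Ndim p n0 n1) sq =
  stat_mse p (quad Sigma (L *m d) (L *m d))
    (nu0^-1 + n0%:R^-1) (nu1^-1 + n1%:R^-1) kappa e0 e1 m.
Proof.
move=> uL LS n00 n10 nu00 nu10 sq.
have [gi ->] := gexp_block_form p (2 + n0 + n1) (coord p d)
    (fun b => e0 * wt0 n0 nu0 b + e1 * wt1 n0 n1 nu1 b)
    (fun b => 1 * wt0 n0 nu0 b + (-1) * wt1 n0 n1 nu1 b) kappa m.
split; first exact: gi.
rewrite (quad_factor _ _ _ _ _ uL LS).
have -> : \sum_(r < p) coord p d r ^+ 2 = \sum_(r < p) d r 0 * d r 0.
  by apply: eq_bigr => r _; rewrite coordE expr2.
have sqE (f0 f1 : R) : \sum_(b < 2 + n0 + n1)
    (f0 * wt0 n0 nu0 b + f1 * wt1 n0 n1 nu1 b) ^+ 2 =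
    f0 * f0 * (nu0^-1 + n0%:R^-1) + f1 * f1 * (nu1^-1 + n1%:R^-1).
  by rewrite -sum_wt_comb//; apply: eq_bigr => b _; rewrite expr2.
have -> : \sum_(b < 2 + n0 + n1)
    (kappa * (1 * wt0 n0 nu0 b + -1 * wt1 n0 n1 nu1 b) +
      (e0 * wt0 n0 nu0 b + e1 * wt1 n0 n1 nu1 b)) ^+ 2 =
    \sum_(b < 2 + n0 + n1)
      ((kappa + e0) * wt0 n0 nu0 b + (e1 - kappa) * wt1 n0 n1 nu1 b) ^+ 2.
  by apply: eq_bigr => b _; ring.
by rewrite !sqE sum_wt_comb// /stat_mse; ring.
Qed.

(** Weight of the sample mean in the posterior mean [mstar]; the rest of the weight sits on the
    deterministic prior mean. *)
Definition shrink (n : nat) (nu : R) : R := n%:R / (n%:R + nu).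

(** In whitened coordinates [mstar] is the prior mean plus [shrink] times its own class noise.
    Subtracting the midpoint of the sample means leaves half of [d] with sign (-1)^i, the own noise
    with coefficient shrink - 1/2, and the other noise with -1/2. *)
Lemma epsB_iE p (Sigma L : 'M[R]_p) m0 m1 n0 n1 nu0 nu1 alpha0 (i : bool) z :
  L \in unitmx -> L *m L^T = Sigma ->
  (0 < n0)%N -> (0 < n1)%N -> 0 < nu0 -> 0 < nu1 ->
  let d := invmx L *m (m0 - m1) in
  let nustar := (if i then n1 else n0)%:R + (if i then nu1 else nu0) in
  epsB_i Sigma m0 m1 n0 n1 nu0 nu1 alpha0
    (xbar L m0 m1 n0 n1 nu0 nu1 z false) (xbar L m0 m1 n0 n1 nu0 nu1 z true) i =
  Phi ((-1) ^+ i *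
    ((- stat p n0 n1 nu0 nu1 d ((-1) ^+ i * 2^-1)
          (if i then - 2^-1 else shrink n0 nu0 - 2^-1)
          (if i then shrink n1 nu1 - 2^-1 else - 2^-1) z + cthr alpha0)
     / Num.sqrt (stat p n0 n1 nu0 nu1 d 1 1 (-1) z)
     * Num.sqrt (nustar / (nustar + 1)))).
Proof.
move=> uL LS n00 n10 nu00 nu10 d nustar; rewrite /epsB_i -/nustar.
rewrite xbar0E// xbar1E//.
rewrite !(stat_quad _ _ _ _ _ _ _ _ _ _ _ _ uL LS).
set N0 := noise _ _ (wt0 _ _) z; set N1 := noise _ _ (wt1 _ _ _) z.
set a0 := invmx L *m m0; set a1 := invmx L *m m1.
have dE : d = a0 - a1 by rewrite /d mulmxBr.
have diffE : L *m (a0 + N0) - L *m (a1 + N1) = L *m (d + N0 - N1).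
  by rewrite -mulmxBr dE opprD addrACA addrA.
have diffE' : d + N0 - N1 = 1 *: d + 1 *: N0 + (-1) *: N1.
  by rewrite !scale1r scaleN1r.
have m0E : m0 = L *m a0 by rewrite mulKVmx.
have m1E : m1 = L *m a1 by rewrite mulKVmx.
have n0R : 0 < n0%:R + nu0 by rewrite addr_gt0// ltr0n.
have n1R : 0 < n1%:R + nu1 by rewrite addr_gt0// ltr0n.
clearbody N0 N1 a0 a1 d; subst d.
rewrite diffE -diffE'; case: i @nustar => nustar /=.
  rewrite [X in quad _ (X - _) _](_ : _ =
      L *m (a1 + shrink n1 nu1 *: N1)); last first.
    rewrite {1}m1E !scalemxAr -mulmxDr scalemxAr; congr (L *m _).
    apply/matrixP => r j; rewrite !mxE /nustar /shrink.
    by field; rewrite gt_eqF.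
  rewrite -mulmxDr scalemxAr -mulmxBr expr1.
  have -> : a1 + shrink n1 nu1 *: N1 - 2^-1 *: (a0 + N0 + (a1 + N1)) =
      (-1 * 2^-1) *: (a0 - a1) + - 2^-1 *: N0 + (shrink n1 nu1 - 2^-1) *: N1.
    by apply/matrixP => r j; rewrite !mxE; field.
  by [].
rewrite [X in quad _ (X - _) _](_ : _ =
    L *m (a0 + shrink n0 nu0 *: N0)); last first.
  rewrite {1}m0E !scalemxAr -mulmxDr scalemxAr; congr (L *m _).
  apply/matrixP => r j; rewrite !mxE /nustar /shrink.
  by field; rewrite gt_eqF.
rewrite -mulmxDr scalemxAr -mulmxBr expr0 mul1r.
have -> : a0 + shrink n0 nu0 *: N0 - 2^-1 *: (a0 + N0 + (a1 + N1)) =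
    (1 * 2^-1) *: (a0 - a1) + (shrink n0 nu0 - 2^-1) *: N0 + - 2^-1 *: N1.
  by apply/matrixP => r j; rewrite !mxE; field.
by rewrite !mul1r.
Qed.
End Discriminant.

(** * Passage to the limit *)

Section PhiRatioLimit.
Context {R : realType}.

(** Joint continuity at (a, b, 1): the limit b > 0 keeps the square root away from 0 there. *)
Lemma Phi_ratio_near (s c a b : R) : 0 < b -> forall eps, 0 < eps ->
  exists2 delta, 0 < delta & forall a' b' t,
    `|a - a'| < delta -> `|b - b'| < delta -> `|1 - t| < delta ->
    `|Phi (s * ((- a' + c) / Num.sqrt b' * t)) - Phi (s * ((- a + c) / Num.sqrt b))|
      <= eps.
Proof.
move=> b0 eps eps0.
pose f (x : R * R * R) := Phi (s * ((- x.1.1 + c) / Num.sqrt x.1.2 * x.2)).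
pose x0 : R * R * R := (a, b, 1).
have f1 : (fun x : R * R * R => x.1.1) x @[x --> x0] --> a.
  by apply: cvg_comp; [exact: cvg_fst|exact: cvg_fst].
have f2 : (fun x : R * R * R => x.1.2) x @[x --> x0] --> b.
  by apply: cvg_comp; [exact: cvg_fst|exact: cvg_snd].
have f3 : (fun x : R * R * R => x.2) x @[x --> x0] --> (1 : R) by exact: cvg_snd.
have fsqrt : Num.sqrt (x.1.2) @[x --> x0] --> Num.sqrt b.
  by apply: cvg_comp f2 _; exact: sqrt_continuous.
have cf : f x @[x --> x0] --> Phi (s * ((- a + c) / Num.sqrt b * 1)).
  apply: (@cvg_comp _ _ _ (fun x : R * R * R =>
    s * ((- x.1.1 + c) / Num.sqrt x.1.2 * x.2)) (@Phi R)); last first.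
    exact: continuous_Phi.
  apply: cvgMl_tmp; apply: cvgM => //; apply: cvgM.
    by apply: cvgD; [exact: cvgN|exact: cvg_cst].
  by apply: cvgV => //; rewrite gt_eqF// sqrtr_gt0.
move/cvgrPdist_le : cf => /(_ _ eps0) /nbhs_ballP[delta /= delta0 H].
exists delta => // a' b' t ha hb ht.
have := H (a', b', t); rewrite /f/= mulr1 distrC; apply.
by split => //; split.
Qed.

Lemma measurable_Phi_ratio dS (S : measurableType dS) (A B : S -> R) (s c t : R) :
  measurable_fun setT A -> measurable_fun setT B ->
  measurable_fun setT (fun x => Phi (s * ((- A x + c) / Num.sqrt (B x) * t))).
Proof.
move=> mA mB.
have mPhi : measurable_fun setT (@Phi R).
  by apply: continuous_measurable_fun; exact: continuous_Phi.
have msqrt : measurable_fun setT (@Num.sqrt R).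
  by apply: continuous_measurable_fun; exact: sqrt_continuous.
apply: (measurableT_comp mPhi).
apply: measurable_funM => //; apply: measurable_funM => //; apply: measurable_funM.
  by apply: measurable_funD => //; exact: measurableT_comp.
(* Inversion is discontinuous at 0, a value that the square root may take; on nonnegative numbers it
   agrees with the real power -1, which is measurable. *)
rewrite (_ : (fun x => _) = (fun x => (Num.sqrt (B x)) `^ (-1))); last first.
  by apply/funext => x; rewrite powR_inv1// sqrtr_ge0.
apply: (measurableT_comp (measurable_powR (-1))).
exact: (measurableT_comp msqrt).
Qed.

Lemma gint_Phi_ratio N (A B : (nat -> R) -> R) (s c t : R) :
  measurable_stream_fun (fun _ : unit => A) ->
  measurable_stream_fun (fun _ : unit => B) ->
  gint N (fun z => Phi (s * ((- A z + c) / Num.sqrt (B z) * t))).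
Proof.
move=> mA mB.
suff H : measurable_stream_fun (fun (_ : unit) z =>
    Phi (s * ((- A z + c) / Num.sqrt (B z) * t))).
  by have [] := gint_bounded N _ _ _ 1 H _ tt => // _ z; rewrite ger0_norm ?Phi_ge0 ?Phi_le1.
move=> dS S tau zeta mtau mzeta.
by apply: measurable_Phi_ratio; [exact: (mA _ S tau)|exact: (mB _ S tau)].
Qed.

Lemma gexp_Phi_ratio_cvg (N : nat -> nat) (A B : nat -> (nat -> R) -> R)
    (t VA VB : nat -> R) (s c a b : R) :
  0 < b -> t @ \oo --> (1 : R) ->
  (forall p, measurable_stream_fun (fun _ : unit => A p)) ->
  (forall p, measurable_stream_fun (fun _ : unit => B p)) ->
  (\forall p \near \oo, gint (N p) (fun z => (A p z - a) ^+ 2) /\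
     gexp (N p) (fun z => (A p z - a) ^+ 2) = VA p) ->
  (\forall p \near \oo, gint (N p) (fun z => (B p z - b) ^+ 2) /\
     gexp (N p) (fun z => (B p z - b) ^+ 2) = VB p) ->
  VA @ \oo --> (0 : R) -> VB @ \oo --> (0 : R) ->
  (fun p => gexp (N p) (fun z =>
     Phi (s * ((- A p z + c) / Num.sqrt (B p z) * t p)))) @ \oo -->
  Phi (s * ((- a + c) / Num.sqrt b)).
Proof.
move=> b0 t1 mA mB gA gB VA0 VB0.
apply/cvgrPdist_le => eps eps0.
have eps2 : 0 < eps / 2 by rewrite divr_gt0.
have [delta delta0 close] := Phi_ratio_near s c a b b0 _ eps2.
(* With this [K], a deviation of [A p] or [B p] by at least [delta] makes the corresponding weighted
   square at least 1, which dominates any difference of two values of [Phi]. The factor [t p] is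
   deterministic, so for large p it is within [delta] of 1 for every [z]. *)
pose K := delta ^- 2.
have K0 : 0 < K by rewrite invr_gt0 exprn_gt0.
have Vcvg : (fun p => K * (VA p + VB p)) @ \oo --> (0 : R).
  by rewrite -(mulr0 K) -[X in K * X](addr0 0); apply: cvgMl_tmp; exact: cvgD.
move/cvgrPdist_lt : t1 => /(_ _ delta0) t_near.
move/cvgrPdist_le : Vcvg => /(_ _ eps2) V_near.
near=> p.
have [gAp EA] : gint (N p) (fun z => (A p z - a) ^+ 2) /\
     gexp (N p) (fun z => (A p z - a) ^+ 2) = VA p by near: p.
have [gBp EB] : gint (N p) (fun z => (B p z - b) ^+ 2) /\
     gexp (N p) (fun z => (B p z - b) ^+ 2) = VB p by near: p.
have tp : `|1 - t p| < delta by near: p; exact: t_near.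
have Vp : K * (VA p + VB p) <= eps / 2.
  suff : `|0 - K * (VA p + VB p)| <= eps / 2.
    by rewrite sub0r normrN; apply: le_trans; exact: ler_norm.
  by near: p; exact: V_near.
have [g1 E1] := gexpD _ _ _ gAp gBp.
have [g2 E2] := gexpZ _ K _ g1.
have [g3 E3] := gexp_cst (N p) (eps / 2).
have [g4 E4] := gexpD _ _ _ g3 g2.
rewrite distrC; apply: le_trans (gexp_dist_le _ _ _ _ _ g4 _) _.
- exact: gint_Phi_ratio.
- move=> z; have dist1 (x y : R) : `|Phi x - Phi y| <= 1.
    have := Phi_ge0 x; have := Phi_le1 x; have := Phi_ge0 y; have := Phi_le1 y.
    by rewrite ler_norml => *; apply/andP; split; lra.
  have weight (x : R) : delta <= `|x| -> 1 <= K * x ^+ 2.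
    move=> dx; rewrite /K mulrC ler_pdivlMr ?exprn_gt0// mul1r -(real_normK (num_real x)).
    by rewrite lerXn2r ?nnegrE ?normr_ge0// ltW.
  have [za|/weight za] := ltP `|a - A p z| delta; last first.
    apply: le_trans (dist1 _ _) _; rewrite -[A p z - a]opprB sqrrN mulrDr.
    by have := mulr_ge0 (ltW K0) (sqr_ge0 (B p z - b)); lra.
  have [zb|/weight zb] := ltP `|b - B p z| delta; last first.
    apply: le_trans (dist1 _ _) _; rewrite -[B p z - b]opprB sqrrN mulrDr.
    by have := mulr_ge0 (ltW K0) (sqr_ge0 (A p z - a)); lra.
  apply: le_trans (close _ _ _ za zb tp) _.
  by rewrite lerDl mulr_ge0 ?(ltW K0)// addr_ge0 ?sqr_ge0.
- by rewrite E4 E3 E2 E1 EA EB; lra.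
Unshelve. all: by end_near. Qed.
End PhiRatioLimit.

(** * Limits of the moments in the asymptotic regime *)

Section Limits.
Context {R : realType}.

Lemma stat_mse_cvg (D s0 s1 e0 e1 : nat -> R) (kappa Dm P0 P1 E0 E1 : R) :
  D @ \oo --> Dm -> s0 @ \oo --> (0 : R) -> s1 @ \oo --> (0 : R) ->
  (fun p => p%:R * s0 p) @ \oo --> P0 -> (fun p => p%:R * s1 p) @ \oo --> P1 ->
  e0 @ \oo --> E0 -> e1 @ \oo --> E1 ->
  (fun p => stat_mse p (D p) (s0 p) (s1 p) kappa (e0 p) (e1 p)
     (kappa * Dm + (E0 * P0 - E1 * P1))) @ \oo --> (0 : R).
Proof.
move=> cD cs0 cs1 cP0 cP1 ce0 ce1; set m := kappa * Dm + _.
(* Every [p%:R] is grouped with one [s0 p] or [s1 p], whose product with it converges; each variance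
   term then keeps a further factor tending to 0, and the bias vanishes by the choice of [m]. *)
rewrite (_ : (fun p => _) = (fun p =>
    (kappa * D p - m + (e0 p * (p%:R * s0 p) - e1 p * (p%:R * s1 p))) ^+ 2
  + D p * ((kappa + e0 p) ^+ 2 * s0 p + (e1 p - kappa) ^+ 2 * s1 p)
  + ((e0 p ^+ 2 * (p%:R * s0 p) + e1 p ^+ 2 * (p%:R * s1 p)) * (s0 p + s1 p)
     + (e0 p * (p%:R * s0 p) - e1 p * (p%:R * s1 p)) * (e0 p * s0 p - e1 p * s1 p))));
  last by apply/funext => p; rewrite /stat_mse; ring.
have -> : (0 : R) =
    (kappa * Dm - m + (E0 * P0 - E1 * P1)) ^+ 2
  + Dm * ((kappa + E0) ^+ 2 * 0 + (E1 - kappa) ^+ 2 * 0)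
  + ((E0 ^+ 2 * P0 + E1 ^+ 2 * P1) * (0 + 0)
     + (E0 * P0 - E1 * P1) * (E0 * 0 - E1 * 0)) by rewrite /m; ring.
have sqr (u : nat -> R) (l : R) : u @ \oo --> l -> (fun p => u p ^+ 2) @ \oo --> l ^+ 2.
  by move=> ul; rewrite expr2; under eq_fun do rewrite expr2; exact: cvgM.
have ccst (x : R) : (fun _ : nat => x) @ \oo --> x by exact: cvg_cst.
have cdiff : (fun p => e0 p * (p%:R * s0 p) - e1 p * (p%:R * s1 p)) @ \oo -->
    E0 * P0 - E1 * P1 by apply: cvgB; apply: cvgM.
apply: cvgD; first apply: cvgD.
- apply: sqr; apply: cvgD; last exact: cdiff.
  by apply: cvgB => //; exact: cvgMl_tmp.
- apply: cvgM => //; apply: cvgD; apply: cvgM => //; apply: sqr.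
    exact: cvgD.
  exact: cvgB.
- apply: cvgD; apply: cvgM.
  + by apply: cvgD; apply: cvgM => //; exact: sqr.
  + exact: cvgD.
  + exact: cdiff.
  + by apply: cvgB; apply: cvgM.
Qed.

Section Regime.
Variables (n : nat -> nat) (nu : nat -> R) (J gamma : R).
Hypotheses (nu0 : forall p, 0 < nu p)
  (ny : (fun p => (n p)%:R : R) @ \oo --> +oo) (nuy : nu @ \oo --> +oo)
  (gamma0 : 0 < gamma)
  (nJ : (fun p => p%:R / (n p)%:R : R) @ \oo --> J)
  (ng : (fun p => nu p / (n p)%:R) @ \oo --> gamma).

Lemma regime_n_gt0 : \forall p \near \oo, (0 < n p)%N.
Proof.
have : \forall p \near \oo, 0 < (n p)%:R :> R by move/cvgryPgt : ny; exact.
by apply: filterS => p; rewrite ltr0n.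
Qed.

Lemma regime_inv_nu : (fun p => (nu p)^-1) @ \oo --> (0 : R).
Proof. by apply/gtr0_cvgV0 => //; exact: nearW. Qed.

Lemma regime_var : (fun p => (nu p)^-1 + (n p)%:R^-1) @ \oo --> (0 : R).
Proof.
rewrite -(addr0 (0 : R)); apply: cvgD; first exact: regime_inv_nu.
apply/gtr0_cvgV0 => //.
by apply: filterS regime_n_gt0 => p; rewrite ltr0n.
Qed.

(** The prior part is p/nu = (p/n)/(nu/n), of limit J/gamma. *)
Lemma regime_pvar : (fun p => p%:R * ((nu p)^-1 + (n p)%:R^-1)) @ \oo --> J + J / gamma.
Proof.
have c : (fun p => p%:R / (n p)%:R + p%:R / (n p)%:R / (nu p / (n p)%:R)) @ \oo -->
    J + J / gamma.
  apply: cvgD => //; apply: cvgM => //; apply: cvgV => //.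
  by rewrite gt_eqF.
apply: cvg_trans c; apply: near_eq_cvg; near=> p.
have np : (n p)%:R != 0 :> R.
  by rewrite pnatr_eq0 -lt0n; near: p; exact: regime_n_gt0.
by field; rewrite np gt_eqF.
Unshelve. all: by end_near. Qed.

Lemma regime_shrink : (fun p => shrink (n p) (nu p)) @ \oo --> (1 + gamma)^-1.
Proof.
have c : (fun p => (1 + nu p / (n p)%:R)^-1) @ \oo --> (1 + gamma)^-1.
  apply: cvgV; first by rewrite gt_eqF// ltr_pwDl// ltW.
  by apply: cvgD => //; exact: cvg_cst.
apply: cvg_trans c; apply: near_eq_cvg; near=> p.
have np : 0 < (n p)%:R :> R.
  by rewrite ltr0n; near: p; exact: regime_n_gt0.
by rewrite /shrink; field; rewrite !gt_eqF// addr_gt0.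
Unshelve. all: by end_near. Qed.

(** The radicand is 1 - 1/(n + nu + 1), squeezed through 1/nu. *)
Lemma regime_factor : (fun p => Num.sqrt (((n p)%:R + nu p) / ((n p)%:R + nu p + 1)))
  @ \oo --> (1 : R).
Proof.
have pos p : 0 < (n p)%:R + nu p by rewrite ltr_wpDl.
have c : (fun p => ((n p)%:R + nu p + 1)^-1) @ \oo --> (0 : R).
  apply: (@squeeze_cvgr _ _ _ _ (cst 0) (fun p => (nu p)^-1)).
  - near=> p => /=; rewrite invr_ge0 addr_ge0 ?(ltW (pos p))//=.
    rewrite lef_pV2 ?posrE ?(addr_gt0 (pos p))//.
    by rewrite -addrA addrCA lerDl addr_ge0.
  - exact: cvg_cst.
  - exact: regime_inv_nu.
have ratio : (fun p => ((n p)%:R + nu p) / ((n p)%:R + nu p + 1)) @ \oo --> (1 : R).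
  rewrite (_ : (fun p => _) = (fun p => 1 - ((n p)%:R + nu p + 1)^-1)); last first.
    by apply/funext => p; field; rewrite gt_eqF// (addr_gt0 (pos p)).
  have : (fun p => 1 - ((n p)%:R + nu p + 1)^-1) @ \oo --> (1 - 0 : R).
    by apply: cvgB => //; exact: cvg_cst.
  by rewrite subr0.
have := cvg_comp _ _ ratio (@sqrt_continuous R 1).
by rewrite sqrtr1.
Unshelve. all: by end_near. Qed.

End Regime.
End Limits.

Theorem theorem2 (R : realType) (alpha0 : R)
  (Sigma L : forall p : nat, 'M[R]_p)
  (n0 n1 : nat -> nat) (nu0 nu1 : nat -> R)
  (m0 m1 : forall p : nat, 'cV[R]_p)
  (J0 J1 gamma0 gamma1 Dm : R) :
  0 < alpha0 < 1 ->
  (forall p, (Sigma p)^T = Sigma p) ->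
  (forall p (v : 'cV[R]_p), v != 0 -> 0 < (v^T *m Sigma p *m v) 0 0) ->
  (forall p, L p *m (L p)^T = Sigma p) ->
  (forall p, 0 < nu0 p) -> (forall p, 0 < nu1 p) ->
  (fun p => (n0 p)%:R : R) @ \oo --> +oo ->
  (fun p => (n1 p)%:R : R) @ \oo --> +oo ->
  nu0 @ \oo --> +oo ->
  nu1 @ \oo --> +oo ->
  0 <= J0 -> 0 <= J1 -> 0 < gamma0 -> 0 < gamma1 ->
  (fun p => p%:R / (n0 p)%:R : R) @ \oo --> J0 ->
  (fun p => p%:R / (n1 p)%:R : R) @ \oo --> J1 ->
  (fun p => nu0 p / (n0 p)%:R) @ \oo --> gamma0 ->
  (fun p => nu1 p / (n1 p)%:R) @ \oo --> gamma1 ->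
  cvg ((fun p => quad (Sigma p) (m0 p) (m0 p)) @ \oo) ->
  cvg ((fun p => quad (Sigma p) (m0 p) (m1 p)) @ \oo) ->
  cvg ((fun p => quad (Sigma p) (m1 p) (m0 p)) @ \oo) ->
  cvg ((fun p => quad (Sigma p) (m1 p) (m1 p)) @ \oo) ->
  (fun p => quad (Sigma p) (m0 p - m1 p) (m0 p - m1 p)) @ \oo --> Dm ->
  let F := Dm + J0 + J1 + J0 / gamma0 + J1 / gamma1 in
  let H0 := 2^-1 * (Dm + J1 - J0 + J0 / gamma0 + J1 / gamma1) in
  let H1 := - (2^-1 * (Dm + J0 - J1 + J0 / gamma0 + J1 / gamma1)) in
  let c := cthr alpha0 in
  0 < F ->
  (forall i : bool,
     (fun p => E_epsB_i (Sigma p) (L p) (m0 p) (m1 p) (n0 p) (n1 p)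
                 (nu0 p) (nu1 p) alpha0 i) @ \oo
     --> Phi ((-1) ^+ i * ((- (if i then H1 else H0) + c) / Num.sqrt F)))
  /\
  (fun p => E_epsB (Sigma p) (L p) (m0 p) (m1 p) (n0 p) (n1 p)
              (nu0 p) (nu1 p) alpha0) @ \oo
  --> alpha0 * Phi ((- H0 + c) / Num.sqrt F)
      + (1 - alpha0) * Phi ((H1 - c) / Num.sqrt F).
Proof.
move=> alpha01 _ posS LS nu0_gt0 nu1_gt0 n0y n1y nu0y nu1y _ _ gamma0_gt0 gamma1_gt0.
move=> n0J n1J n0g n1g _ _ _ _ cD F H0 H1 c F_gt0.
have uL p : L p \in unitmx := factor_unitmx _ _ _ (posS p) (LS p).
pose d p := invmx (L p) *m (m0 p - m1 p).
pose e0 (i : bool) p := if i then - 2^-1 else shrink (n0 p) (nu0 p) - 2^-1 : R.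
pose e1 (i : bool) p := if i then shrink (n1 p) (nu1 p) - 2^-1 else - 2^-1 : R.
pose A (i : bool) p := stat p (n0 p) (n1 p) (nu0 p) (nu1 p) (d p)
  ((-1) ^+ i * 2^-1) (e0 i p) (e1 i p).
pose B p := stat p (n0 p) (n1 p) (nu0 p) (nu1 p) (d p) 1 1 (-1).
pose nustar (i : bool) p := (if i then n1 p else n0 p)%:R + (if i then nu1 p else nu0 p).
pose t (i : bool) p : R := Num.sqrt (nustar i p / (nustar i p + 1)).
pose G (i : bool) p z := Phi ((-1) ^+ i * ((- A i p z + c) / Num.sqrt (B p z) * t i p)).
have mA i p : measurable_stream_fun (fun _ : unit => A i p).
  by move=> dS S tau zeta _ mzeta; exact: measurable_block_form.
have mB p : measurable_stream_fun (fun _ : unit => B p).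
  by move=> dS S tau zeta _ mzeta; exact: measurable_block_form.
have n0_gt0 := regime_n_gt0 _ n0y.
have n1_gt0 := regime_n_gt0 _ n1y.
have var0 := regime_var _ _ nu0_gt0 n0y nu0y.
have var1 := regime_var _ _ nu1_gt0 n1y nu1y.
have pvar0 := regime_pvar _ _ _ _ nu0_gt0 n0y gamma0_gt0 n0J n0g.
have pvar1 := regime_pvar _ _ _ _ nu1_gt0 n1y gamma1_gt0 n1J n1g.
(* The moment formula holds only eventually, once both samples are nonempty. Since [L p *m d p] is
   m0 - m1, it depends on the prior means only through their Mahalanobis distance, whatever the
   factor [L]. *)
have moments kappa f0 f1 m : \forall p \near \oo,
    let S := stat p (n0 p) (n1 p) (nu0 p) (nu1 p) (d p) kappa (f0 p) (f1 p) in
    gint (Ndim p (n0 p) (n1 p)) (fun z => (S z - m) ^+ 2) /\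
    gexp (Ndim p (n0 p) (n1 p)) (fun z => (S z - m) ^+ 2) =
    stat_mse p (quad (Sigma p) (m0 p - m1 p) (m0 p - m1 p))
      ((nu0 p)^-1 + (n0 p)%:R^-1) ((nu1 p)^-1 + (n1 p)%:R^-1) kappa (f0 p) (f1 p) m.
  near=> p.
  have n0p : (0 < n0 p)%N by near: p.
  have n1p : (0 < n1 p)%N by near: p.
  have := gexp_stat p (Sigma p) (L p) (n0 p) (n1 p) (nu0 p) (nu1 p) (d p)
    kappa (f0 p) (f1 p) m (uL p) (LS p) n0p n1p (nu0_gt0 p) (nu1_gt0 p).
  by rewrite mulKVmx.
have limG i : (fun p => gexp (Ndim p (n0 p) (n1 p)) (G i p)) @ \oo -->
    Phi ((-1) ^+ i * ((- (if i then H1 else H0) + c) / Num.sqrt F)).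
  pose E0 : R := if i then - 2^-1 else (1 + gamma0)^-1 - 2^-1.
  pose E1 : R := if i then (1 + gamma1)^-1 - 2^-1 else - 2^-1.
  have ccst (x : R) : (fun _ : nat => x) @ \oo --> x by exact: cvg_cst.
  have ce0 : e0 i @ \oo --> E0.
    rewrite /e0 /E0; case: (i) => //; apply: cvgB => //.
    exact: regime_shrink.
  have ce1 : e1 i @ \oo --> E1.
    rewrite /e1 /E1; case: (i) => //; apply: cvgB => //.
    exact: regime_shrink.
  (* As (J + J/gamma)/(1 + gamma) = J/gamma, the class i itself contributes (J/gamma - J)/2 and the
     other class (J + J/gamma)/2, both with sign (-1)^i. *)
  have HE : (if i then H1 else H0) = (-1) ^+ i * 2^-1 * Dm +
      (E0 * (J0 + J0 / gamma0) - E1 * (J1 + J1 / gamma1)).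
    rewrite /H0 /H1 /E0 /E1; case: (i); rewrite ?expr0 ?expr1.
      by field; rewrite !gt_eqF// addr_gt0.
    by field; rewrite !gt_eqF// addr_gt0.
  have FE : F = 1 * Dm + (1 * (J0 + J0 / gamma0) - (-1) * (J1 + J1 / gamma1)).
    by rewrite /F; ring.
  have tE : t i @ \oo --> (1 : R).
    by rewrite /t /nustar; case: (i); exact: regime_factor.
  have VA := stat_mse_cvg _ _ _ _ _ ((-1) ^+ i * 2^-1) _ _ _ _ _
    cD var0 var1 pvar0 pvar1 ce0 ce1.
  have VB := stat_mse_cvg _ _ _ _ _ 1 _ _ _ _ _
    cD var0 var1 pvar0 pvar1 (ccst 1) (ccst (-1)).
  rewrite -HE in VA; rewrite -FE in VB.
  exact: (gexp_Phi_ratio_cvg _ (A i) B (t i) _ _ _ _ _ _ F_gt0 tE (mA i) mB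
    (moments _ _ _ _) (moments _ (fun=> 1) (fun=> -1) _) VA VB).
have epsE i : \forall p \near \oo, (fun z => epsB_i (Sigma p) (m0 p) (m1 p) (n0 p) (n1 p)
      (nu0 p) (nu1 p) alpha0
      (xbar (L p) (m0 p) (m1 p) (n0 p) (n1 p) (nu0 p) (nu1 p) z false)
      (xbar (L p) (m0 p) (m1 p) (n0 p) (n1 p) (nu0 p) (nu1 p) z true) i) = G i p.
  near=> p; apply/funext => z; apply: epsB_iE => //; near: p.
    exact: n0_gt0.
  exact: n1_gt0.
split=> [i|].
  apply: cvg_trans (limG i); apply: near_eq_cvg.
  by apply: filterS (epsE i) => p Ep; rewrite /E_epsB_i Ep.
have limE : (fun p => alpha0 * gexp (Ndim p (n0 p) (n1 p)) (G false p) +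
    (1 - alpha0) * gexp (Ndim p (n0 p) (n1 p)) (G true p)) @ \oo -->
    alpha0 * Phi ((- H0 + c) / Num.sqrt F) + (1 - alpha0) * Phi ((H1 - c) / Num.sqrt F).
  apply: cvgD; apply: cvgMl_tmp.
    by have := limG false; rewrite expr0 mul1r.
  by have := limG true; rewrite expr1 mulN1r -mulNr opprD opprK.
apply: cvg_trans limE; apply: near_eq_cvg.
apply: filterS2 (epsE false) (epsE true) => p E0 E1.
(* Splitting the expectation of the weighted sum requires integrability of each summand at fixed
   [p], which the boundedness of [Phi] provides. *)
have gG i : gint (Ndim p (n0 p) (n1 p)) (G i p) by exact: gint_Phi_ratio.
have [g0 <-] := gexpZ _ alpha0 _ (gG false).
have [g1 <-] := gexpZ _ (1 - alpha0) _ (gG true).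
have [_ <-] := gexpD _ _ _ g0 g1.
rewrite /E_epsB; congr (gexp _ _); apply/funext => z.
by rewrite -E0 -E1.
Unshelve. all: by end_near. Qed.
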